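(* Let $\tau,\rho\colon\mathbb{R}_+\to\mathbb{R}_+$ be two positive unbounded increasing continuous functions such that $\tau(r)=o(\rho(r))$ as $r\to\infty$. Then there exists $\Lambda\subset\{z\in\mathbb{C}: -\operatorname{Im} z\ge\tau(|z|)\}$ whose counting function $n$ satisfies $n(r)\le\rho(r)$ and which is not a subset of $\operatorname{Res}(q)$ for any real-valued $q\in L^1(\mathbb{R}_+)$ with compact support.
   Context: $\mathbb{R}_+=[0,+\infty)$. The counting function of $\Lambda$ is $n(r)=\#\{\lambda\in\Lambda:|\lambda|<r\}$. For a real-valued compactly supported $q\in L^1(\mathbb{R}_+)$, consider the one-dimensional Schrödinger operator $-\frac{d^2}{dx^2}+q(x)$ on $\mathbb{R}_+$. For $k\in\mathbb{C}$, its Jost solution $\psi(k,x)$ is the unique solution of $-\psi''(k,x)+q(x)\psi(k,x)=k^2\psi(k,x)$, $x\ge 0$ (derivatives in $x$), that satisfies $\psi(k,x)=e^{ikx}$ for all large $x$. The Jost function is $w(k)=\psi(k,0)$; it is an entire function of $k$. The resonances are the zeros of $w$ in the open lower half-plane $\{z:\operatorname{Im} z<0\}$, and $\operatorname{Res}(q)$ denotes the set of resonances; strictly speaking it is a multiset, in which the multiplicity of each resonance equals the multiplicity of the corresponding zero of $w$.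
   Formalization: The formal theorem also assumes τ(r)<r for arbitrarily large r; without this the region −Im z ≥ τ(|z|) can be empty (e.g. τ(r)=r+1), so Λ=∅ lies in every Res(q). Excluded: τ(r)≥r for all large r, where the region is, up to a bounded set, at most part of the negative imaginary axis. *)

(* Defs.v *)
From mathcomp Require Export all_boot all_order all_algebra.
From mathcomp Require Export complex.
From mathcomp Require Export all_classical all_reals all_analysis.
Export Order.TTheory GRing.Theory Num.Theory numFieldNormedType.Exports.

Set Implicit Arguments.
Unset Strict Implicit.
Unset Printing Implicit Defensive.

Local Open Scope classical_set_scope.
Local Open Scope ring_scope.
Local Open Scope complex_scope.

(* The modulus of a complex number, as an element of R ([`|z|] lives in R[i]). *)
Definition cmod (R : realType) (z : R[i]) : R := ComplexField.Normc.normc z.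

Definition cexp (R : realType) (z : R[i]) : R[i] :=
  (expR (complex.Re z))%:C * (cos (complex.Im z) +i* sin (complex.Im z)).

Definition is_derive_C (R : realType) (f : R -> R[i]) (x : R) (l : R[i]) : Prop :=
  is_derive x (1 : R) (fun t => complex.Re (f t)) (complex.Re l) /\
  is_derive x (1 : R) (fun t => complex.Im (f t)) (complex.Im l).

(* [s] lists the endpoints of finitely many non-overlapping subintervals of
   [a, b], from left to right. *)
Definition abs_continuous_on (R : realType) (a b : R) (f : R -> R[i]) : Prop :=
  forall e : R, 0 < e -> exists2 d : R, 0 < d &
    forall s : seq (R * R),
      all (fun p => [&& a <= p.1, p.1 <= p.2 & p.2 <= b]) s ->
      pairwise (fun p p' => p.2 <= p'.1) s ->
      \sum_(p <- s) (p.2 - p.1) < d ->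
      \sum_(p <- s) cmod (f p.2 - f p.1) < e.

Definition loc_abs_continuous (R : realType) (f : R -> R[i]) : Prop :=
  forall b : R, 0 < b -> abs_continuous_on 0 b f.

(* Since q is only integrable, - psi'' + q psi = k^2 psi on [0, +oo) is meant in
   the usual sense: psi and psi' are locally absolutely continuous and the
   equation holds almost everywhere.  The derivative psi1 of psi is required at
   x > 0 only; at 0 the right derivative is psi1 0, by continuity of psi and
   psi1. *)
Definition schrodinger_solution (R : realType) (q : R -> R) (k : R[i])
    (psi : R -> R[i]) : Prop :=
  exists psi1 : R -> R[i],
    [/\ loc_abs_continuous psi,
        loc_abs_continuous psi1,
        forall x : R, 0 < x -> is_derive_C psi x (psi1 x) &
        {ae lebesgue_measure, forall x : R, 0 < x ->
           exists2 psi2 : R[i], is_derive_C psi1 x psi2 &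
             - psi2 + (q x)%:C * psi x = k ^+ 2 * psi x}].

Definition is_jost_solution (R : realType) (q : R -> R) (k : R[i])
    (psi : R -> R[i]) : Prop :=
  schrodinger_solution q k psi /\
  exists M : R, forall x : R, M <= x -> psi x = cexp ('i * k * x%:C).

(* For q as in [potential] below, the Jost solution exists and is unique on
   [0, +oo); its values at x < 0, which [xget] picks arbitrarily, are never
   used. *)
Definition jost_solution (R : realType) (q : R -> R) (k : R[i]) : R -> R[i] :=
  xget (fun=> 0) [set psi | is_jost_solution q k psi].

Definition jost_function (R : realType) (q : R -> R) (k : R[i]) : R[i] :=
  jost_solution q k 0.

(* The underlying set of the multiset of resonances.  A set Lambda, having all
   its multiplicities equal to 1, is contained in the multiset if and only if it
   is contained in the underlying set. *)
Definition resonances (R : realType) (q : R -> R) : set R[i] :=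
  [set k | complex.Im k < 0 /\ jost_function q k = 0].

(* q is in L^1([0, +oo)) with compact (essential) support; its values at x < 0
   are irrelevant. *)
Definition potential (R : realType) (q : R -> R) : Prop :=
  lebesgue_measure.-integrable `[0, +oo[ (EFin \o q) /\
  exists M : R, {ae lebesgue_measure, forall x : R, M < x -> q x = 0}.

(* The counting function n(r), in \bar R so that it is +oo when infinitely many
   points of Lambda have modulus < r. *)
Definition counting_function (R : realType) (Lambda : set R[i]) (r : R) : \bar R :=
  counting (Lambda `&` [set z | cmod z < r]).

(* Main.v *)
Require Import Defs.
From mathcomp Require finmap.
From mathcomp Require Import measurable_realfun.
From mathcomp Require Import cyclic separable cyclotomic ring lra.

(* Writing the Jost solution as e^(ikx) m, the pair (m, g) = (m, m') solves
   m' = g, g' = q m - 2ik g with m = 1 and g = 0 beyond the support of q.  Picard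
   iteration shows that w(k) = m(0) is a locally uniform limit of polynomials in
   k, and a Gronwall estimate that |w(k)| <= C exp(2 M (Im k)_-) and that w tends
   to 1 as Im k -> +oo.  By a Jensen-type inequality around x + i T, the number of
   zeros of w within distance 2 T + 1 of x + i T is therefore O(T).  The set
   Lambda is made of clusters near x_j - i T_j, with T_j close to tau(r_j), each
   of about rho(r_j) / 2 points; since tau = o(rho) this is too many. *)

Set Implicit Arguments.
Unset Strict Implicit.
Unset Printing Implicit Defensive.

Local Open Scope classical_set_scope.
Local Open Scope ring_scope.
Local Open Scope complex_scope.

(** * Zeros of limits of polynomials *)

(** Means over roots of unity replace contour integrals. They are exact for polynomials, which is
    why w is approximated by polynomials. The Jensen-type inequality needs a centre where w is not
    small: |w| >= 1/2 at x + i T once T >= 27 Q, with Q the integral of |q| over [0, M]. The cluster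
    lies within 2 T + 1 of that centre; the disc three times larger goes down to Im k = - (5 T + 3),
    where |w| <= C exp (2 M (5 T + 3)), and every zero gains a factor 2. The resulting O(T) has a
    constant depending on q and M, whereas one Lambda has to defeat every q. The cluster of index n
    therefore satisfies n T <= rho, so that its number of points, about n T / 2 at least, is too
    large once n exceeds a constant of q. As all clusters together must respect rho, each index is
    chosen after the earlier points have been counted. Real and imaginary parts are kept apart, so
    that absolute continuity, integration and Gronwall's inequality concern real functions only. *)

Lemma prim_root_exists (C : numClosedFieldType) (n : nat) :
  (0 < n)%N -> exists z : C, n.-primitive_root z.
Proof.
move=> n0; have [r] := closed_field_poly_normal ('X^n - 1 : {poly C}).
rewrite (monicP _) ?monicXnsubC // scale1r => rE.
suff /hasP[z _ zn] : has n.-primitive_root r by exists z.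
apply: (has_prim_root n0).
- by apply/allP => z; rewrite -root_prod_XsubC -rE.
- by rewrite -separable_prod_XsubC -rE separable_Xn_sub_1// pnatr_eq0 -lt0n.
- by rewrite -ltnS -(size_prod_XsubC r id) -rE size_XnsubC.
Qed.

(** The mean value property at the centre of a circle, discretised: for 0 < k < N the number
    [w ^+ k] is an N-th root of unity other than 1, so its geometric sum vanishes and only the
    constant coefficient survives. *)
Lemma sum_horner_prim_root (F : fieldType) (N : nat) (w r : F) (p : {poly F}) :
  N.-primitive_root w -> (size p <= N)%N ->
  \sum_(l < N) p.[r * w ^+ l] = p.[0] *+ N.
Proof.
move=> wN pN; have N0 := prim_order_gt0 wN.
under eq_bigr do rewrite (horner_coef_wide _ pN).
rewrite exchange_big/=.
have vanish k : (0 < k < N)%N -> \sum_(l < N) (w ^+ k) ^+ l = 0.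
  move=> /andP[k0 kN].
  have : (w ^+ k - 1) * \sum_(l < N) (w ^+ k) ^+ l = 0.
    by rewrite -subrX1 -exprM mulnC exprM (prim_expr_order wN) expr1n subrr.
  move/eqP; rewrite mulf_eq0 => /orP[|/eqP//].
  by rewrite subr_eq0 -(prim_order_dvd wN) => /(dvdn_leq k0); rewrite leqNgt kN.
rewrite (bigD1 (Ordinal N0))//= [X in _ + X]big1 => [|j j0].
  under eq_bigr do rewrite /= expr0 mulr1.
  by rewrite sumr_const card_ord addr0 horner_coef0.
under eq_bigr do rewrite exprMn mulrA exprAC.
by rewrite -mulr_sumr vanish ?mulr0// ltn_ord andbT lt0n.
Qed.

Section jensen.
Variable C : numClosedFieldType.
Implicit Types (p q : {poly C}) (s : seq C) (r B : C).

Lemma norm_horner0_le p r B : 0 <= r ->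
  (forall u, `|u| = r -> `|p.[u]| <= B) -> `|p.[0]| <= B.
Proof.
move=> r0 pB; have [w wN] := prim_root_exists C (ltn0Sn (size p)).
have := sum_horner_prim_root r wN (leqnSn _).
move=> /(congr1 (fun x => `|x|)); rewrite normrMn => h.
have w1 : `|w| = 1.
  apply/eqP; rewrite -(@pexpr_eq1 _ _ (size p).+1)//.
  by rewrite -normrX (prim_expr_order wN) normr1.
rewrite -(ler_pMn2r (ltn0Sn (size p))) -h.
apply: le_trans (ler_norm_sum _ _ _) _.
rewrite -[X in _ *+ X](card_ord (size p).+1) -sumr_const; apply: ler_sum => i _.
by apply: pB; rewrite normrM normrX w1 expr1n mulr1 ger0_norm.
Qed.

(** Each linear factor has modulus at least 2 r / 3 on the circle and at most r / 3 at the centre.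
    Applying the mean value bound to the cofactor [q] alone therefore gains 1 / 2 for each root,
    without the Blaschke factors of Jensen's formula. *)
Lemma norm_horner0_le_roots q s r B : 0 < r -> 0 <= B ->
  (forall z, z \in s -> `|z| <= r / 3) ->
  (forall u, `|u| = r -> `|(q * \prod_(z <- s) ('X - z%:P)).[u]| <= B) ->
  `|(q * \prod_(z <- s) ('X - z%:P)).[0]| <= B / 2 ^+ size s.
Proof.
move=> r0 B0 sr qB.
have r3 : 0 < r / 3 by rewrite divr_gt0// ltr0n.
have low u : `|u| = r -> (2 * (r / 3)) ^+ size s <= `|(\prod_(z <- s) ('X - z%:P)).[u]|.
  move=> ur; elim: s sr {qB} => [|z s IH] sr.
    by rewrite big_nil hornerC normr1.
  have r2 : 0 <= 2 * (r / 3) by rewrite mulr_ge0 ?ler0n// ltW.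
  rewrite big_cons hornerM normrM exprS; apply: ler_pM => //; first exact: exprn_ge0.
    rewrite hornerXsubC; apply: le_trans (lerB_dist _ _).
    rewrite ur lerBrDl; rewrite [leRHS](_ : r = r / 3 + 2 * (r / 3)); last by field.
    by rewrite lerD2r sr ?mem_head.
  by apply: IH => v vs; rewrite sr// in_cons vs orbT.
have up : `|(\prod_(z <- s) ('X - z%:P)).[0]| <= (r / 3) ^+ size s.
  elim: s sr {qB low} => [|z s IH] sr.
    by rewrite big_nil hornerC normr1.
  rewrite big_cons hornerM normrM exprS; apply: ler_pM => //.
    by rewrite hornerXsubC sub0r normrN sr ?mem_head.
  by apply: IH => v vs; rewrite sr// in_cons vs orbT.
have P0 : 0 < (2 * (r / 3)) ^+ size s by rewrite exprn_gt0// mulr_gt0// ltr0n.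
have q0 : `|q.[0]| <= B / (2 * (r / 3)) ^+ size s.
  apply: (norm_horner0_le (ltW r0)) => u ur.
  rewrite ler_pdivlMr//; apply: le_trans (qB u ur).
  by rewrite hornerM normrM ler_wpM2l// low.
rewrite hornerM normrM; apply: le_trans (ler_pM _ _ q0 up) _ => //.
rewrite exprMn invfM -!mulrA mulVf ?mulr1// expf_neq0// gt_eqF//.
Qed.

Lemma horner_norm_le p r u : `|u| <= r ->
  `|p.[u]| <= \sum_(i < size p) `|p`_i| * r ^+ i.
Proof.
move=> ur; rewrite horner_coef; apply: le_trans (ler_norm_sum _ _ _) _.
apply: ler_sum => i _; rewrite normrM normrX ler_wpM2l// lerXn2r//.
by rewrite nnegrE (le_trans _ ur).
Qed.


(* Subtracting from an approximating polynomial the Lagrange interpolant L of its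
   small values on s makes it vanish on s. *)
Lemma jensen s (f : C -> C) r B : 0 < r -> 0 <= B -> uniq s ->
  (forall z, z \in s -> `|z| <= r / 3 /\ f z = 0) ->
  (forall e, 0 < e -> exists p, forall u, `|u| <= r -> `|f u - p.[u]| <= e) ->
  (forall u, `|u| <= r -> `|f u| <= B) ->
  `|f 0| <= B / 2 ^+ size s.
Proof.
move=> r0 B0 us fs fp fB.
pose l z := \prod_(v <- rem z s) ((z - v)^-1 *: ('X - v%:P)).
pose K := \sum_(z <- s) \sum_(i < size (l z)) `|(l z)`_i| * r ^+ i.
have K0 : 0 <= K.
  by rewrite !sumr_ge0// => z _; rewrite sumr_ge0// => i _; rewrite mulr_ge0// exprn_ge0// ltW.
have lE z v : z \in s -> v \in s -> (l z).[v] = (z == v)%:R.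
  move=> zs vs; rewrite horner_prod; case: eqVneq => [<-|zv].
    rewrite big_seq big1// => u us'; rewrite hornerZ hornerXsubC mulVf// subr_eq0.
    by apply: contraTneq us' => <-; rewrite mem_rem_uniqF.
  apply/eqP; rewrite prodf_seq_eq0; apply/hasP; exists v => /=.
    by rewrite mem_rem_uniq// !inE eq_sym zv.
  by rewrite hornerZ hornerXsubC subrr mulr0.
have fp' e : 0 < e -> `|f 0| <= B / 2 ^+ size s + (e + K * e + e + K * e).
  move=> e0; have [p pf] := fp e e0.
  pose L := \sum_(z <- s) p.[z] *: l z.
  have pz z : z \in s -> `|p.[z]| <= e.
    move=> zs; have [zr fz] := fs z zs.
    have := pf z; rewrite fz sub0r normrN; apply.
    by rewrite (le_trans zr)// ler_pdivrMr ?ltr0n// ler_peMr ?ler1n// ltW.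
  have Le u : `|u| <= r -> `|L.[u]| <= K * e.
    move=> ur; rewrite horner_sum (le_trans (ler_norm_sum _ _ _))//.
    rewrite mulr_suml !big_seq; apply: ler_sum => z zs.
    by rewrite hornerZ normrM mulrC ler_pM// ?pz// horner_norm_le.
  have root_pL : all (root (p - L)) s.
    apply/allP => z zs; rewrite rootE hornerD hornerN horner_sum.
    rewrite (bigD1_seq z)//= hornerZ lE// eqxx mulr1 big_seq_cond big1 ?addr0 ?subrr// => v.
    by move=> /andP[vs vz]; rewrite hornerZ lE// (negPf vz) mulr0.
  have [q qE] : exists q, p - L = q * \prod_(z <- s) ('X - z%:P).
    by apply: uniq_roots_prod_XsubC => //; rewrite uniq_rootsE.
  have pLu u : `|u| <= r -> `|f u - (p - L).[u]| <= e + K * e.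
    move=> ur; rewrite hornerD hornerN [X in `|X|](_ : _ = (f u - p.[u]) + L.[u]); last by ring.
    by rewrite (le_trans (ler_normD _ _))// lerD// ?Le// pf.
  have h : `|(p - L).[0]| <= (B + (e + K * e)) / 2 ^+ size s.
    rewrite qE; apply: (norm_horner0_le_roots r0) => //.
    - by rewrite !addr_ge0 ?mulr_ge0// ltW.
    - by move=> z /fs[].
    - move=> u ur; rewrite -qE.
      have -> : (p - L).[u] = f u - (f u - (p - L).[u]) by ring.
      by rewrite (le_trans (ler_normB _ _))// lerD// ?fB ?pLu ?ur.
  have -> : f 0 = (p - L).[0] + (f 0 - (p - L).[0]) by ring.
  rewrite [leRHS](_ : _ = (B / 2 ^+ size s + (e + K * e)) + (e + K * e)); last by ring.
  rewrite (le_trans (ler_normD _ _))// lerD//.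
    rewrite (le_trans h)// mulrDl lerD2l// ler_pdivrMr ?exprn_gt0 ?ltr0n//.
    by rewrite ler_peMr ?exprn_ege1 ?ler1n// addr_ge0 ?mulr_ge0// ltW.
  by rewrite pLu// normr0 ltW.
rewrite -[leRHS]addr0; apply/ler_addgt0Pr => e e0; rewrite addr0.
(* The four error terms of [fp'] add up to 2 (1 + K) times the approximation error. *)
have K1 : 0 < 2 * (1 + K) by rewrite mulr_gt0 ?ltr0n// ltr_pwDl.
apply: le_trans (fp' (e / (2 * (1 + K))) _) _; first by rewrite divr_gt0.
rewrite lerD2l le_eqVlt; apply/orP; left; apply/eqP; field.
by move: K1; rewrite pmulr_rgt0 ?ltr0n// => /lt0r_neq0.
Qed.

End jensen.

(** * Absolutely continuous functions *)

Section real_induction.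
Variable R : realType.
Implicit Types a b x u v : R.

(** Continuous induction, through the supremum of the points where [T] holds. A step may start at
    any nearby [u <= x] and land at any nearby [v >= x], so that a single hypothesis covers both
    reaching the supremum from below and going past it. *)
Lemma real_induction a b (T : R -> Prop) : a <= b -> T a ->
  (forall x, a <= x <= b -> exists2 d, 0 < d &
     forall u v, a <= u -> v <= b -> x - d < u -> u <= x -> x <= v -> v < x + d ->
       T u -> T v) ->
  T b.
Proof.
move=> ab Ta step.
pose S := [set x | a <= x <= b /\ T x].
have Sa : S a by split => //; rewrite lexx.
have Sub : ubound S b by move=> x [] /andP[].
have hS : has_sup S by split; [exists a|exists b].
have ac : a <= sup S by apply: sup_upper_bound.
have cb : sup S <= b by apply: ge_sup; [exists a|].
have [|d d0 dP] := step (sup S); first by rewrite ac.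
have [u [/andP[au ub] Tu] cu] := sup_adherent d0 hS.
have uc : u <= sup S by apply: sup_upper_bound => //; split => //; rewrite au.
have nxt v : sup S <= v -> v <= b -> v < sup S + d -> T v.
  by move=> cv vb vd; apply: (dP u v).
have [cb'|cb'] := ltP (sup S) b; last first.
  by apply: nxt => //; rewrite ltr_pwDr// (le_lt_trans cb').
pose v := Num.min b (sup S + d / 2).
have cv : sup S < v by rewrite lt_min cb' ltrDl divr_gt0.
have vb : v <= b by rewrite ge_min lexx.
suff /(sup_upper_bound hS) : S v by rewrite leNgt cv.
split; first by rewrite vb andbT (le_trans ac)// ltW.
apply: nxt => //; first exact: ltW.
rewrite /v gt_min; apply/orP; right; rewrite ltrD2l; lra.
Qed.

End real_induction.

#[local] Instance ae_lebesgue_filter (R : realType) :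
  Filter (nbhs (almost_everywhere (@lebesgue_measure R))).
Proof. exact: (ae_filter_ringOfSetsType lebesgue_measure). Qed.

Section absolute_continuity.
Variable R : realType.
Implicit Types (a b x y : R) (f g : R -> R).
Notation mu := (@lebesgue_measure R).

Definition subdiv a b (s : seq (R * R)) :=
  all (fun p => [&& a <= p.1, p.1 <= p.2 & p.2 <= b]) s /\
  pairwise (fun p p' : R * R => p.2 <= p'.1) s.

Definition AC a b f := forall e : R, 0 < e -> exists2 d : R, 0 < d &
  forall s, subdiv a b s ->
    \sum_(p <- s) (p.2 - p.1) < d -> \sum_(p <- s) `|f p.2 - f p.1| < e.

Lemma is_derive_near f x l e : is_derive x 1 f l -> 0 < e ->
  exists2 d : R, 0 < d & forall y, `|y - x| < d ->
    `|f y - f x - l * (y - x)| <= e * `|y - x|.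
Proof.
move=> [/derivable_nbhsP/eqaddoP h dl] /h; rewrite dl => /nbhs_ballP[d /= d0 dP].
exists d => // y xy.
have := dP (y - x); rewrite /ball/= sub0r normrN => /(_ xy).
by rewrite /= /shift/= !fctE [_%:A]mulr1 subrK opprD addrA [(y - x) *: l]mulrC.
Qed.

Lemma subdiv_rcons a x y s : subdiv a x s -> a <= x -> x <= y ->
  forall z, x <= z -> z <= y -> subdiv a y (rcons s (z, y)).
Proof.
move=> [s1 s2] ax xy z xz zy; split.
  rewrite all_rcons /= (le_trans ax xz) zy lexx /=.
  by apply: sub_all s1 => p /and3P[-> -> /le_trans->].
rewrite pairwise_rcons s2 andbT; apply: sub_all s1 => p /and3P[_ _ /= px].
exact: le_trans px xz.
Qed.

(* The exceptional null set is covered by an open set U of measure less than d.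
   Climbing from a to b by real induction, the steps inside U cost at most e
   altogether by absolute continuity, the others at most e (b - a). *)
Lemma AC_ge (a b : R) f (df : R -> R) : a <= b -> AC a b f ->
  {ae mu, forall x, a < x -> x < b -> is_derive x 1 f (df x)} ->
  (forall x, a < x -> x < b -> 0 <= df x) ->
  f a <= f b.
Proof.
move=> ab fAC [N [mN N0 Nf]] df0.
apply/ler_addgt0Pr => e' e'0.
pose e := e' / (2 + (b - a)).
have ba0 : 0 < 2 + (b - a) by lra.
have e0 : 0 < e by rewrite divr_gt0.
have [d d0 dP] := fAC e e0.
(* The derivative is assumed strictly between a and b, so the endpoints join the exceptional set and
   are crossed by steps inside U. *)
pose N' := N `|` [set a] `|` [set b].
have mN' : measurable N'.
  by do 2 (apply: measurableU => //).
have muN' : mu N' = 0%E.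
  have h (A : set R) (c : R) : measurable A -> mu A = 0%E -> mu (A `|` [set c]) = 0%E.
    move=> mA A0; apply/eqP; rewrite eq_le measure_ge0 andbT.
    have : (mu (A `|` [set c]) <= mu A + mu [set c])%E by exact: measureU2.
    by rewrite A0 add0e lebesgue_measure_set1.
  by rewrite /N' !h//; apply: measurableU.
have [|U [oU NU muU]] := @lebesgue_regularity_outer R _ d mN' _ d0.
  by rewrite [X in (X < _)%E](_ : _ = 0%E)//; exact: muN'.
have mU := open_measurable oU.
have {}muU : (mu U < d%:E)%E.
  apply: le_lt_trans muU.
  have : (mu (N' `|` (U `\` N')) <= mu N' + mu (U `\` N'))%E.
    by apply: measureU2 => //; exact: measurableD.
  by rewrite [X in (_ <= X + _)%E](_ : _ = 0%E) ?add0e ?setDUK//; exact: muN'.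
(* The list [s] collects the steps made inside U. Comparing their total length with the measure of U
   up to x keeps it below d, so that at b absolute continuity bounds the last sum by e. *)
pose T x := exists s, [/\ subdiv a x s,
  ((\sum_(p <- s) (p.2 - p.1))%:E <= mu (U `&` `]a, x]))%E &
  f a - f x <= e * (x - a) + \sum_(p <- s) `|f p.2 - f p.1|].
have : T b.
  apply: (real_induction ab).
    exists [::]; split => //; first by rewrite big_nil measure_ge0.
    by rewrite big_nil !subrr mulr0 addr0.
  move=> x /andP[ax xb].
  have [xN|xN] := pselect (N' x).
    have : nbhs x U by apply: open_nbhs_nbhs; split => //; exact: NU.
    move=> /nbhs_ballP[d1/= d10 d1U]; exists d1 => //.
    move=> u v au vb xu ux xv vx [s [s1 s2 s3]].
    have u_v := le_trans ux xv.
    exists (rcons s (u, v)); split.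
    - by apply: (subdiv_rcons s1 au u_v).
    - rewrite big_rcons/= EFinD.
      have -> : U `&` `]a, v] = (U `&` `]a, u]) `|` `]u, v].
        apply/seteqP; split => z /=; rewrite !in_itv/=.
          move=> [Uz /andP[az zv]]; case: (leP z u) => zu; [left|right] => //;
            by rewrite ?az ?zv.
        move=> [[Uz /andP[az zu]]|/andP[uz zv]]; first by rewrite az (le_trans zu).
        rewrite (le_lt_trans au uz) zv; split => //; apply: d1U.
        by rewrite /ball/= ltr_distl; apply/andP; split; lra.
      have dj : (U `&` `]a, u]) `&` `]u, v] = set0.
        apply/seteqP; split => z //= [[_]]; rewrite !in_itv/= => /andP[_ zu] /andP[].
        by rewrite ltNge zu.
      have mI : measurable (U `&` `]a, u]) by exact: measurableI.
      have -> : mu (U `&` `]a, u] `|` `]u, v]) = (mu (U `&` `]a, u]) + mu `]u, v])%E.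
        exact: measureU.
      have muuv : ((v - u)%:E <= mu `]u, v])%E.
        rewrite lebesgue_measure_itv/= lte_fin.
        by case: ltP => // vu; rewrite lee_fin subr_le0.
      by rewrite leeD//.
    - rewrite big_rcons/=.
      have := ler_norm (- (f v - f u)); rewrite normrN.
      have : 0 <= e * (v - u) by rewrite mulr_ge0 ?subr_ge0// ltW.
      lra.
  have ax' : a < x.
    rewrite lt_neqAle ax andbT; apply/eqP => xa; apply: xN; left; right; exact/esym.
  have xb' : x < b.
    by rewrite lt_neqAle xb andbT; apply/eqP => xa; apply: xN; right.
  have dx : is_derive x 1 f (df x).
    by apply: contrapT => h; apply: xN; left; left; apply: Nf => /(_ ax' xb').
  have [d1 d10 d1P] : exists2 d1, 0 < d1 & forall u v, x - d1 < u -> u <= x ->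
      x <= v -> v < x + d1 -> f u - f v <= e * (v - u).
    have [d1 d10 d1P] := is_derive_near dx e0; exists d1 => // u v xu ux xv vx.
    have := d1P u; have := d1P v; have := df0 x ax' xb'.
    rewrite !ler_norml (ger0_norm (_ : 0 <= v - x)) ?subr_ge0//.
    rewrite (ler0_norm (_ : u - x <= 0)) ?subr_le0// ltrBlDl => l0 /(_ vx)/andP[hv _].
    have ux' : - (u - x) < d1 by lra.
    move=> /(_ ux')/andP[_ hu].
    have := mulr_ge0 l0 (_ : 0 <= v - x); rewrite subr_ge0 => /(_ xv).
    have := mulr_ge0 l0 (_ : 0 <= x - u); rewrite subr_ge0 => /(_ ux).
    lra.
  exists d1 => // u v au vb xu ux xv vx [s [s1 s2 s3]].
  have uv := le_trans ux xv.
  exists s; split.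
  - case: s1 => s11 s12; split => //; apply: sub_all s11 => p /and3P[-> ->].
    by move/le_trans => ->.
  - apply: le_trans s2 _; apply: le_measure; rewrite ?inE; try exact: measurableI.
    by apply: setIS => z /=; rewrite !in_itv/= => /andP[-> /le_trans->].
  - have := d1P u v xu ux xv vx; lra.
move=> [s [s1 s2 s3]].
have := dP s s1 _.
have /[swap] /[apply] : \sum_(p <- s) (p.2 - p.1) < d.
  rewrite -lte_fin; apply: le_lt_trans s2 _; apply: le_lt_trans muU.
  by apply: le_measure; rewrite ?inE//; exact: measurableI.
have -> : e' = e * (2 + (b - a)) by rewrite /e divfK// gt_eqF.
by rewrite mulrDr; lra.
Qed.


End absolute_continuity.

Section absolute_continuity.
Variable R : realType.
Implicit Types (a b x y : R) (f g : R -> R).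
Notation mu := (@lebesgue_measure R).

Lemma subdivS a b a' b' s : a <= a' -> b' <= b -> subdiv a' b' s -> subdiv a b s.
Proof.
move=> aa bb [s1 s2]; split=> //; apply: sub_all s1 => p /and3P[h1 -> h2].
by rewrite (le_trans aa h1) (le_trans h2 bb).
Qed.

Lemma ACS a b a' b' f : a <= a' -> b' <= b -> AC a b f -> AC a' b' f.
Proof.
move=> aa bb fAC e e0; have [d d0 dP] := fAC e e0.
by exists d => // s /(subdivS aa bb); exact: dP.
Qed.

Lemma AC_dist a b f : AC a b f -> forall e, 0 < e -> exists2 d, 0 < d &
  forall x y, a <= x -> x <= y -> y <= b -> y - x < d -> `|f y - f x| < e.
Proof.
move=> fAC e e0; have [d d0 dP] := fAC e e0; exists d => // x y ax xy yb yx.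
have := dP [:: (x, y)]; rewrite !big_seq1/=; apply => //.
by split; rewrite //= ax xy yb.
Qed.

Lemma AC_bounded a b f : a <= b -> AC a b f ->
  exists K, forall x, a <= x -> x <= b -> `|f x| <= K.
Proof.
move=> ab /AC_dist/(_ 1 ltr01)[d d0 dP].
apply: (real_induction (T := fun v => exists K, forall x, a <= x -> x <= v -> `|f x| <= K) ab).
  by exists `|f a| => x ax xa; rewrite (_ : x = a)//; apply/eqP; rewrite eq_le xa.
move=> x _; exists (d / 2); first by lra.
move=> u v au vb xu ux xv vx [K KP]; exists (K + 1) => y ay yv.
have [yu|uy] := leP y u; first by rewrite (le_trans (KP _ ay yu))// lerDl.
rewrite [X in `|X|](_ : _ = f u + (f y - f u)); last by ring.
rewrite (le_trans (ler_normD _ _))// lerD//; first exact: KP.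
by apply/ltW/dP => //; [exact: ltW|exact: le_trans yv vb|lra].
Qed.

(** Closure under sums, products and exponentials always comes from a Lipschitz control of
    increments; the passage from such a control to absolute continuity is made here once and for
    all. *)
Lemma AC_dominated a b f g h (K : R) : AC a b f -> AC a b g ->
  (forall x y, a <= x -> x <= y -> y <= b ->
     `|h y - h x| <= K * (`|f y - f x| + `|g y - g x|)) ->
  AC a b h.
Proof.
move=> fAC gAC hP e e0.
pose K' := 1 + `|K|; have K'0 : 0 < K' by rewrite ltr_pwDl.
have e'0 : 0 < e / K' / 2 by rewrite !divr_gt0.
have [d d0 dP] := fAC _ e'0; have [d' d'0 d'P] := gAC _ e'0.
exists (Num.min d d'); first by rewrite lt_min d0.
move=> s ss; rewrite lt_min => /andP[sd sd'].
apply: (@le_lt_trans _ _ (K' * (\sum_(p <- s) `|f p.2 - f p.1| + \sum_(p <- s) `|g p.2 - g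
  p.1|))).
  rewrite -big_split/= mulr_sumr !big_seq; apply: ler_sum => p ps.
  have /allP/(_ _ ps)/and3P[h1 h2 h3] := ss.1.
  apply: le_trans (hP _ _ h1 h2 h3) _; rewrite ler_wpM2r ?addr_ge0//.
  by rewrite (le_trans (ler_norm _))// lerDr.
have -> : e = K' * (e / K' / 2 + e / K' / 2) by field; rewrite gt_eqF.
by rewrite ltr_pM2l// ltrD ?dP ?d'P.
Qed.

Lemma AC_id a b : AC a b id.
Proof.
move=> e e0; exists e => // s [s1 _]; apply: le_lt_trans.
rewrite !big_seq; apply: ler_sum => p /(allP s1)/and3P[_ h _].
by rewrite ger0_norm// subr_ge0.
Qed.

Lemma AC_cst a b c : AC a b (fun=> c).
Proof.
apply: (AC_dominated (K := 0) (@AC_id a b) (@AC_id a b)) => x y _ _ _.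
by rewrite subrr normr0 mul0r.
Qed.

Lemma ACM a b f g : a <= b -> AC a b f -> AC a b g -> AC a b (fun x => f x * g x).
Proof.
move=> ab fAC gAC; have [K KP] := AC_bounded ab fAC; have [L LP] := AC_bounded ab gAC.
apply: (AC_dominated (K := K + L) fAC gAC) => x y ax xy yb.
have -> : f y * g y - f x * g x = (f y - f x) * g y + f x * (g y - g x) by ring.
rewrite (le_trans (ler_normD _ _))// !normrM.
have := LP _ (le_trans ax xy) yb; have := KP _ ax (le_trans xy yb).
have := normr_ge0 (f x); have := normr_ge0 (g y).
have := normr_ge0 (f y - f x); have := normr_ge0 (g y - g x).
nra.
Qed.

Lemma ACD a b f g : AC a b f -> AC a b g -> AC a b (fun x => f x + g x).
Proof.
move=> fAC gAC; apply: (AC_dominated (K := 1) fAC gAC) => x y _ _ _.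
by rewrite mul1r opprD addrACA ler_normD.
Qed.

Lemma expR_lip (K x y : R) : x <= K -> y <= K ->
  `|expR y - expR x| <= expR K * `|y - x|.
Proof.
wlog xy : x y / x <= y => [h xK yK|xK yK].
  have [xy|yx] := leP x y; first exact: h.
  by rewrite distrC [`|y - x|]distrC; apply: h => //; exact: ltW.
rewrite !ger0_norm ?subr_ge0 ?ler_expR//.
have -> : expR y - expR x = expR y * (1 - expR (x - y)).
  by rewrite mulrBr mulr1 -expRD; congr (_ - expR _); ring.
rewrite ler_pM ?expR_ge0 ?subr_ge0 ?ler_expR//.
  by rewrite -expR0 ler_expR subr_le0.
by have := expR_ge1Dx (x - y); lra.
Qed.

Lemma AC_exp a b f : a <= b -> AC a b f -> AC a b (fun x => expR (f x)).
Proof.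
move=> ab fAC; have [K KP] := AC_bounded ab fAC.
apply: (AC_dominated (K := expR K) fAC fAC) => x y ax xy yb.
apply: le_trans (expR_lip (K := K) _ _) _.
- by rewrite (le_trans (ler_norm _))// KP// (le_trans xy yb).
- by rewrite (le_trans (ler_norm _))// KP// (le_trans ax xy).
- by rewrite ler_wpM2l ?expR_ge0// lerDl.
Qed.

(** A relation rather than a derivative operator: the almost everywhere derivative is carried as an
    explicit expression, computed by the usual rules and alterable on null sets. For q merely
    integrable, this is the sense in which the differential equations hold. *)
Definition ac_derive f (phi : R -> R) := (forall b, 0 < b -> AC 0 b f) /\
  {ae mu, forall x, 0 < x -> is_derive x 1 f (phi x)}.

Lemma ac_derive_cst c : ac_derive (fun=> c) (fun=> 0).
Proof.
split=> [b _|]; first exact: AC_cst.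
by apply: aeW => x x0; exact: is_derive_cst.
Qed.

Lemma ac_derive_id : ac_derive id (fun=> 1).
Proof.
split=> [b _|]; first exact: AC_id.
by apply: aeW => x x0; exact: is_derive_id.
Qed.

Lemma ac_deriveD f g phi psi : ac_derive f phi -> ac_derive g psi ->
  ac_derive (fun x => f x + g x) (fun x => phi x + psi x).
Proof.
move=> [fAC df] [gAC dg]; split=> [b b0|]; first by apply: ACD; auto.
apply: filterS2 df dg => x df dg x0.
by have := df x0; have := dg x0 => dgx dfx; exact: is_deriveD.
Qed.

Lemma ac_deriveM f g phi psi : ac_derive f phi -> ac_derive g psi ->
  ac_derive (fun x => f x * g x) (fun x => phi x * g x + f x * psi x).
Proof.
move=> [fAC df] [gAC dg]; split=> [b b0|]; first by apply: ACM; auto; exact: ltW.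
apply: filterS2 df dg => x df dg x0.
have := df x0; have := dg x0 => dgx dfx.
rewrite (_ : _ + _ = f x *: psi x + g x *: phi x); first exact: is_deriveM.
by rewrite addrC [phi x * _]mulrC.
Qed.

Lemma ac_derive_exp f phi : ac_derive f phi ->
  ac_derive (fun x => expR (f x)) (fun x => phi x * expR (f x)).
Proof.
move=> [fAC df]; split=> [b b0|]; first by apply: AC_exp; auto; exact: ltW.
apply: filterS df => x df x0; have dfx := df x0.
rewrite mulrC; exact: (is_derive1_comp (f := expR) (is_derive_expR (f x)) dfx).
Qed.

Lemma ac_derive_eq f g phi psi : ac_derive f phi -> (forall x, 0 <= x -> f x = g x) ->
  {ae mu, forall x, 0 < x -> phi x = psi x} -> ac_derive g psi.
Proof.
move=> [fAC df] fg ae; split=> [b b0|].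
  apply: (AC_dominated (K := 1) (fAC b b0) (@AC_cst 0 b 0)) => x y x0 xy yb.
  by rewrite !fg// ?(le_trans x0 xy)// mul1r subrr normr0 addr0.
apply: filterS2 df ae => x df pp x0; rewrite -pp//; have dfx := df x0.
apply: near_eq_is_derive dfx.
near=> y; rewrite fg//; apply/ltW; near: y; exact: lt_nbhsr.
Unshelve. all: by end_near. Qed.

Lemma ac_deriveZ (c : R) f phi : ac_derive f phi -> ac_derive (fun x => c * f x) (fun x =>
  c * phi x).
Proof.
move=> df; apply: ac_derive_eq (ac_deriveM (ac_derive_cst c) df) _ _ => //.
by apply: aeW => x x0; rewrite mul0r add0r.
Qed.

Lemma ac_derive_sum (I : Type) (r : seq I) (f phi : I -> R -> R) :
  (forall i, ac_derive (f i) (phi i)) ->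
  ac_derive (fun x => \sum_(i <- r) f i x) (fun x => \sum_(i <- r) phi i x).
Proof.
move=> fP; elim: r => [|i r IH].
  apply: ac_derive_eq (ac_derive_cst 0) _ _ => [x _|]; first by rewrite big_nil.
  by apply: aeW => x _; rewrite big_nil.
apply: ac_derive_eq (ac_deriveD (fP i) IH) _ _ => [x _|]; first by rewrite big_cons.
by apply: aeW => x _; rewrite big_cons.
Qed.

Lemma ac_derive_le f phi x y : ac_derive f phi -> 0 <= x -> x <= y ->
  (forall z, x < z -> z < y -> 0 <= phi z) -> f x <= f y.
Proof.
move=> [fAC df] x0; rewrite le_eqVlt => /orP[/eqP->//|xy] p0.
apply: (AC_ge (ltW xy) _ _ p0).
  by apply: (ACS x0 (lexx y)); apply: fAC; exact: le_lt_trans x0 xy.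
by apply: filterS df => z dz xz _; apply: dz; exact: le_lt_trans x0 xz.
Qed.

(** The derivative of the product is (e + h E) exp H, so the product is nondecreasing. It is used
    from right to left: the data are known at the right end and the value at 0 is sought. *)
Lemma gronwall E H e h x y : ac_derive E e -> ac_derive H h -> 0 <= x -> x <= y ->
  (forall z, x < z -> z < y -> 0 <= e z + h z * E z) ->
  E x * expR (H x) <= E y * expR (H y).
Proof.
move=> dE dH x0 xy eh; apply: (ac_derive_le (ac_deriveM dE (ac_derive_exp dH)) x0 xy) =>
  z xz zy.
have -> : e z * expR (H z) + E z * (h z * expR (H z)) = (e z + h z * E z) * expR (H z).
  by ring.
by rewrite mulr_ge0 ?expR_ge0// eh.
Qed.

End absolute_continuity.

(** * Primitives of integrable functions *)

Section primitive.
Variables (R : realType) (M : R).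
Hypothesis M0 : 0 < M.
Notation mu := (@lebesgue_measure R).
Implicit Types (phi psi u v : R -> R) (x y : R).

Let I : set R := `[0, M].
Let mI : measurable I. Proof. exact: measurable_itv. Qed.
Let muI : (mu I < +oo)%E.
Proof. by rewrite /I lebesgue_measure_itv/= lte_fin M0 -EFinB ltry. Qed.

Definition integ phi := mu.-integrable I (EFin \o phi).

(** Minus the integral of phi over the part of [0, M] to the right of x, so that it vanishes beyond
    M. Written as a difference, it falls under the fundamental theorem for integrals over []-oo,
    x]]. *)
Definition prim phi x : R :=
  (\int[mu]_(t in `]-oo, x]) (phi \_ I) t - \int[mu]_(t in `]-oo, +oo[) (phi \_ I) t)%R.

Let integT phi : integ phi -> mu.-integrable setT (EFin \o (phi \_ I)).
Proof. by move=> /integrable_mkcond -/(_ mI); rewrite restrict_EFin. Qed.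

Let integS phi (A : set R) : integ phi -> measurable A ->
  mu.-integrable A (EFin \o (phi \_ I)).
Proof. by move=> /integT h mA; apply: integrableS h. Qed.

Lemma prim_sub phi x y : integ phi -> x <= y ->
  prim phi y - prim phi x = (\int[mu]_(t in `]x, y]) (phi \_ I) t)%R.
Proof.
move=> h xy; rewrite /prim opprB addrA subrK Rintegral_itvB//.
exact: integS.
Qed.

Lemma prim_AC phi a b : integ phi -> AC a b (prim phi).
Proof.
move=> h e e0; have [d [d0 dP]] := integral_normr_continuous (integT h) e0.
have {}dP : forall A : set R, measurable A -> (mu A < d%:E)%E ->
  (\int[mu]_(x in A) `|(phi \_ I) x| < e)%R := dP.
exists d => // s [s1 s2] sd.
pose U (r : seq (R * R)) : set R := \big[setU/set0]_(p <- r) `]p.1, p.2]%classic.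
have mU r : measurable (U r) by apply: bigsetU_measurable => p _; exact: measurable_itv.
have muU r : all (fun p => p.1 <= p.2) r ->
    (mu (U r) <= (\sum_(p <- r) (p.2 - p.1))%:E)%E.
  elim: r => [|p r IH]; first by rewrite /U !big_nil measure0.
  move=> /= /andP[pp /IH{}IH]; rewrite /U !big_cons EFinD.
  have : (mu (`]p.1, p.2]%classic `|` U r) <= mu `]p.1, p.2] + mu (U r))%E.
    by apply: measureU2; [exact: measurable_itv|exact: mU].
  move=> /le_trans; apply; apply: leeD => //.
  rewrite lebesgue_measure_itv/= lte_fin; case: ltP => // _.
  by rewrite lee_fin subr_ge0.
have s3 : all (fun p => p.1 <= p.2) s by apply: sub_all s1 => p /and3P[].
apply: le_lt_trans (dP (U s) (mU s) _); last first.
  by apply: le_lt_trans (muU s s3) _; rewrite lte_fin.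
have intn (A : set R) : measurable A -> mu.-integrable A (EFin \o (fun x => `|(phi \_ I) x|)).
  by move=> mA; exact: (integrable_norm (integS h mA)).
elim: s s2 s3 {s1 sd} => [|p r IH]; first by rewrite /U !big_nil Rintegral_set0.
move=> /= /andP[pr r2] /andP[pp r3].
have -> : U (p :: r) = `]p.1, p.2]%classic `|` U r by rewrite /U big_cons.
rewrite big_cons.
have mp : measurable (`]p.1, p.2]%classic : set R) by exact: measurable_itv.
have -> : (\int[mu]_(x in `]p.1, p.2] `|` U r) `|(phi \_ I) x| =
   \int[mu]_(x in `]p.1, p.2]) `|(phi \_ I) x| + \int[mu]_(x in U r) `|(phi \_ I) x|)%R.
  apply: Rintegral_setU => //; first exact: mU.
    by apply: intn; exact: measurableU mp (mU r).
  apply/disj_setPS => z /= [+]; rewrite in_itv/= => /andP[_ zp].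
  rewrite /U -bigcup_seq => -[p' /= p'r]; rewrite in_itv/= => /andP[p'z _].
  by have := allP pr _ p'r => /=; rewrite leNgt (lt_le_trans p'z).
apply: lerD; last exact: IH.
rewrite prim_sub//; apply: le_normr_Rintegral => //; exact: integS.
Qed.

Lemma prim_continuous phi : integ phi -> continuous (prim phi).
Proof.
move=> h x; apply/cvgrPdist_lt => e e0.
have [d d0 dP] := AC_dist (prim_AC (x - 1) (x + 1) h) e0.
have d10 : 0 < Num.min d 1 by rewrite lt_min d0 ltr01.
apply: filterS (nbhsx_ballx x _ d10) => y; rewrite /ball/= lt_min => /andP[xyd];
  rewrite ltr_distl => /andP[y1 y2].
case: (leP x y) => xy.
  rewrite distrC; apply: dP; rewrite ?lerBlDr ?lerDl//; first by lra.
  by rewrite (le_lt_trans _ xyd)// distrC ler_norm.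
apply: dP; [by lra|exact: ltW|by rewrite lerDl|].
by rewrite (le_lt_trans _ xyd)// ler_norm.
Qed.

Let restrE phi x : (forall y, M < y -> phi y = 0) -> 0 < x -> (phi \_ I) x = phi x.
Proof.
move=> phi0 x0; rewrite patchE; case: ifPn => // /negP xI; rewrite phi0// ltNge.
by apply/negP => xM; apply: xI; rewrite inE /I/= in_itv/= xM ltW.
Qed.

Lemma prim_ac_derive phi : integ phi -> (forall y, M < y -> phi y = 0) ->
  ac_derive (prim phi) phi.
Proof.
move=> h phi0; split=> [b _|]; first exact: prim_AC.
have : {ae mu, forall x, derivable (fun y => \int[mu]_(t in `]-oo, y]) (phi \_ I) t)%R x 1 /\
    derive1 (fun y => \int[mu]_(t in `]-oo, y]) (phi \_ I) t)%R x = (phi \_ I) x}.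
  apply: FTC1Ny => [y|]; first exact: integS.
  exact: integrable_locally.
apply: filterS => x [dF FE] x0; rewrite -(restrE phi0 x0) -FE derive1E -[X in is_derive _ _ _
  X]subr0.
by apply: is_deriveB; exact: DeriveDef.
Qed.

(** Continuity at x gives a derivative at x itself and not just almost everywhere. This serves the
    first derivative of a Jost solution, which must exist at every x > 0. *)
Lemma prim_derive phi x : integ phi -> (forall y, M < y -> phi y = 0) -> 0 < x ->
  {for x, continuous phi} -> is_derive x 1 (prim phi) (phi x).
Proof.
move=> h phi0 x0 cx.
have [||||dF FE] := @continuous_FTC1 R (phi \_ I) -oo%O x (x + 1) _ (integS h _).
- by rewrite ltrDl.
- exact: measurable_itv.
- by rewrite ltNyr.
- have E : \forall y \near x, phi y = (phi \_ I) y.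
    by near=> y; rewrite restrE//; near: y; exact: lt_nbhsr.
  have E2 : (phi \_ I) x = phi x by rewrite restrE.
  move: cx; rewrite /prop_for /continuous_at E2; apply: cvg_trans.
  exact: near_eq_cvg.
rewrite -(restrE phi0 x0) -FE derive1E -[X in is_derive _ _ _ X]subr0.
by apply: is_deriveB; exact: DeriveDef.
Unshelve. all: by end_near. Qed.

Lemma prim0 phi x : integ phi -> M <= x -> prim phi x = 0.
Proof.
move=> h Mx; apply/eqP; rewrite -oppr_eq0 /prim opprB Rintegral_itvB//.
  rewrite (@eq_Rintegral _ _ _ _ _ (cst 0)); first by rewrite Rintegral_cst// mul0r.
  move=> y; rewrite inE/= in_itv/= andbT => xy; rewrite patchE ifF//.
  by apply/negP; rewrite inE /I/= in_itv/= => /andP[_]; rewrite leNgt (le_lt_trans Mx).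
exact: integS.
Qed.

(** The multipliers that preserve integrability, so that q times an iterate can be integrated
    again. *)
Definition bmeas u := measurable_fun I u /\
  exists K, forall x, 0 <= x -> x <= M -> `|u x| <= K.

Let bmeas_bounded u : bmeas u -> [bounded u x | x in I].
Proof.
move=> [_ [K KP]]; exists K; split; first exact: num_real.
move=> y Ky x; rewrite /I/= in_itv/= => /andP[x0 xM].
by rewrite (le_trans (KP _ x0 xM))// ltW.
Qed.

Lemma bmeas_prim phi : integ phi -> bmeas (prim phi).
Proof.
move=> h; split; last exact: (AC_bounded (ltW M0) (prim_AC 0 M h)).
by apply: measurable_funTS; apply: continuous_measurable_fun; exact: prim_continuous.
Qed.

Lemma bmeas_cst c : bmeas (fun=> c).
Proof. by split; [exact: measurable_cst|exists `|c|]. Qed.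

Lemma bmeas_integ u : bmeas u -> integ u.
Proof.
move=> nu; apply: measurable_bounded_integrable => //; first exact: nu.1.
exact: bmeas_bounded.
Qed.

Lemma integ_mul phi u : integ phi -> bmeas u -> integ (fun x => phi x * u x).
Proof.
move=> h nu; have := @integrableMl _ _ _ mu I mI _ u h nu.1 (bmeas_bounded nu).
by apply: eq_integrable => // x _; rewrite /= EFinM.
Qed.

Lemma integD phi psi : integ phi -> integ psi -> integ (fun x => phi x + psi x).
Proof.
move=> h1 h2; have := @integrableD _ _ _ mu I mI _ _ h1 h2.
by apply: eq_integrable => // x _; rewrite /= EFinD.
Qed.

Lemma integZ (c : R) phi : integ phi -> integ (fun x => c * phi x).
Proof.
move=> h; have := @integrableZl _ _ _ mu I mI c _ h.
by apply: eq_integrable => // x _; rewrite /= EFinM.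
Qed.

Lemma integ_norm phi : integ phi -> integ (fun x => `|phi x|).
Proof. by move=> h; exact: integrable_norm. Qed.

End primitive.

(** * Picard iteration for the Jost solution *)

Lemma series_tail (R : realType) (u v : R^nat) : (forall n, `|u n| <= v n) ->
  cvgn (series v) -> cvgn (series u) /\
    forall N, `|limn (series u) - series u N| <= limn (series v) - series v N.
Proof.
move=> uv cv; have v0 n : 0 <= v n by exact: le_trans (uv n).
have cu : cvgn (series u).
  by apply: normed_cvg; apply: (series_le_cvg _ v0 uv cv) => n; exact: normr_ge0.
split=> // N.
have c1 : `|series u n - series u N| @[n --> \oo] --> `|limn (series u) - series u N|.
  by apply: cvg_norm; apply: cvgB; [exact: cu|exact: cvg_cst].
rewrite -(cvg_lim _ c1)//; apply: limr_le; first by apply/cvg_ex; eexists; exact: c1.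
near=> n.
have Nn : (N <= n)%N by near: n; exact: nbhs_infty_ge.
rewrite sub_series_geq// (le_trans (ler_norm_sum _ _ _))//.
apply: (@le_trans _ _ (series v n - series v N)).
  by rewrite sub_series_geq//; apply: ler_sum => i _; exact: uv.
rewrite lerD2r; apply: nondecreasing_cvgn_le => //.
by apply: nondecreasing_series => i _ _; exact: v0.
Unshelve. all: by end_near. Qed.

Section picard.
Variables (R : realType) (M : R) (q : R -> R).
Hypothesis M0 : 0 < M.
Hypothesis iq : integ M q.
Hypothesis q0 : forall x, M < x -> q x = 0.
Notation mu := (@lebesgue_measure R).
Implicit Types (x y : R) (n j : nat).

(** Multiplication by kappa, read on the coefficients of a polynomial in kappa. *)
Definition shiftf (g : nat -> R -> R) j : R -> R := if j is j'.+1 then g j' else fun=> 0.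

(* The coefficients of [kappa ^+ j] in the [n]-th Picard iterates of the system
   m' = g, g' = q m - kappa g with m = 1 and g = 0 beyond M. *)
Fixpoint iter_mg n : (nat -> R -> R) * (nat -> R -> R) :=
  if n is n'.+1 then
    (fun j => prim M ((iter_mg n').2 j),
     fun j => prim M (fun x => q x * (iter_mg n').1 j x + (- 1) * shiftf (iter_mg n').2 j x))
  else (fun j _ => (j == 0)%:R, fun _ _ => 0).

Notation mm n := (iter_mg n).1.
Notation gg n := (iter_mg n).2.

Lemma iter_bmeas n : (forall j, bmeas M (mm n j)) /\ (forall j, bmeas M (gg n j)) /\
  (forall j x, M < x -> gg n j x = 0).
Proof.
elim: n => [|n [mn [gn gn0]]]; first by split; [|split] => // j; exact: bmeas_cst.
have int2 j : integ M (fun x => q x * mm n j x + (- 1) * shiftf (gg n) j x).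
  apply: integD => //; first exact: integ_mul.
  apply: integZ => //; apply: bmeas_integ => //; case: j => [|j] //=; exact: bmeas_cst.
split; [|split] => [j|j|j x Mx] /=; first by apply: bmeas_prim => //; exact: bmeas_integ.
  exact: bmeas_prim.
by rewrite prim0//; exact: ltW.
Qed.

Lemma iter_integ n j : integ M (fun x => q x * mm n j x + (- 1) * shiftf (gg n) j x).
Proof.
have [mn [gn gn0]] := iter_bmeas n; apply: integD => //; first exact: integ_mul.
apply: integZ => //; apply: bmeas_integ => //; case: j => [|j] //=; exact: bmeas_cst.
Qed.

Lemma iter_m_ac_derive n j : ac_derive (mm n.+1 j) (gg n j).
Proof.
have [mn [gn gn0]] := iter_bmeas n.
by apply: prim_ac_derive; [exact: bmeas_integ|exact: gn0].
Qed.

Lemma iter_g_ac_derive n j : ac_derive (gg n.+1 j)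
  (fun x => q x * mm n j x + (- 1) * shiftf (gg n) j x).
Proof.
have [mn [gn gn0]] := iter_bmeas n.
apply: prim_ac_derive; first exact: iter_integ.
by move=> y My; rewrite q0// mul0r add0r; case: j => [|j] /=; rewrite ?gn0// mulr0.
Qed.

(** Only the zeroth iterate carries the boundary value m = 1: the iterates are the successive terms
    of a Neumann series, and the solution is their sum. *)
Lemma iter_end n j x : M <= x -> mm n j x = (n == 0)%:R * (j == 0)%:R /\ gg n j x = 0.
Proof.
move=> Mx; case: n => [|n] /=; first by rewrite mul1r.
have [mn [gn gn0]] := iter_bmeas n.
rewrite mul0r !prim0//; first exact: iter_integ.
exact: bmeas_integ.
Qed.

(** Each iteration multiplies by kappa at most once, so the degree in kappa is at most n and the
    finite sums of [lincomb] lose nothing. *)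
Lemma iter_degree n j x : (n < j)%N -> mm n j x = 0 /\ gg n j x = 0.
Proof.
elim: n j x => [|n IH] j x nj; first by rewrite /= gtn_eqF.
have p0 : prim M (fun=> 0) x = 0.
  have h (A : set R) : measurable A -> (\int[mu]_(t in A) ((fun=> 0 : R) \_ `[0, M]) t)%R = 0.
    move=> mA; rewrite (@eq_Rintegral _ _ _ _ _ (cst 0)) ?Rintegral_cst ?mul0r// => y _.
    by rewrite patchE; case: ifP.
  by rewrite /prim !h ?subrr.
split=> /=.
  by rewrite (_ : gg n j = fun=> 0)//; apply/funext => y; rewrite (IH _ _ (ltnW nj)).2.
rewrite [X in prim M X](_ : _ = fun=> 0)//; apply/funext => y.
rewrite (IH _ _ (ltnW nj)).1; case: j nj => // j nj /=.
by rewrite (IH _ _ nj).2 !mulr0 addr0.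
Qed.

End picard.

(** * Factorial bounds on the Picard iterates *)

Section picard_bound.
Variables (R : realType) (M : R) (q : R -> R).
Hypothesis M0 : 0 < M.
Hypothesis iq : integ M q.
Hypothesis q0 : forall x, M < x -> q x = 0.
Notation mu := (@lebesgue_measure R).
Implicit Types (x y : R) (n j : nat) (f phi : R -> R).

Notation mm n := (iter_mg M q n).1.
Notation gg n := (iter_mg M q n).2.

(** With [cf j] the real or the imaginary part of the j-th power of kappa, this is one part of an
    iterate: as q is real, the coefficients [h j] are real functions and the two parts separate. *)
Definition lincomb (cf : nat -> R) (h : nat -> R -> R) n x : R :=
  \sum_(j < n.+1) cf j * h j x.

Lemma lincomb_m_ac_derive cf n :
  ac_derive (lincomb cf (mm n.+1) n.+1) (lincomb cf (gg n) n).
Proof.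
have := ac_derive_sum (index_enum 'I_n.+2) (fun j : 'I_n.+2 =>
  ac_deriveZ (cf j) (iter_m_ac_derive M0 iq n j)).
move/ac_derive_eq; apply=> //.
apply: aeW => x _; rewrite /lincomb big_ord_recr/=.
by rewrite (iter_degree M q _ (leqnn _)).2 mulr0 addr0.
Qed.

Lemma lincomb_g_ac_derive cf n :
  ac_derive (lincomb cf (gg n.+1) n.+1)
    (fun x => q x * lincomb cf (mm n) n x - lincomb (cf \o succn) (gg n) n x).
Proof.
have := ac_derive_sum (index_enum 'I_n.+2) (fun j : 'I_n.+2 =>
  ac_deriveZ (cf j) (iter_g_ac_derive M0 iq q0 n j)).
move/ac_derive_eq; apply=> //.
apply: aeW => x _.
under eq_bigr do rewrite mulrDr mulN1r mulrN mulrCA.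
rewrite sumrB; congr (_ - _); last first.
  by rewrite big_ord_recl/= mulr0 add0r.
rewrite -mulr_sumr big_ord_recr/= /lincomb.
by rewrite (iter_degree M q _ (leqnn _)).1 mulr0 addr0.
Qed.

Lemma lincomb_end cf n x : M <= x ->
  lincomb cf (mm n) n x = (n == 0)%:R * cf 0 /\ lincomb cf (gg n) n x = 0.
Proof.
move=> Mx; split; last first.
  by rewrite /lincomb big1// => j _; rewrite (iter_end M0 iq _ _ Mx).2 mulr0.
rewrite /lincomb big_ord_recl/= big1 => [|j _]; rewrite (iter_end M0 iq _ _ Mx).1.
  by rewrite eqxx mulr1 addr0 mulrC.
by rewrite !mulr0.
Qed.

Lemma lincomb_bmeas cf n : bmeas M (lincomb cf (mm n) n) /\ bmeas M (lincomb cf (gg n) n).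
Proof.
have [mn [gn gn0]] := iter_bmeas M0 iq n.
have h (u : nat -> R -> R) : (forall j, bmeas M (u j)) -> bmeas M (lincomb cf u n).
  move=> un; split.
    apply: measurable_sum => j; apply: measurable_funM; first exact: measurable_cst.
    exact: (un _).1.
  have /choice[K KP] : forall j, exists K, forall x, 0 <= x -> x <= M -> `|u j x| <= K.
    by move=> j; exact: (un j).2.
  exists (\sum_(j < n.+1) `|cf j| * K j) => x x0 xM.
  rewrite (le_trans (ler_norm_sum _ _ _))//; apply: ler_sum => j _.
  by rewrite normrM ler_wpM2l// KP.
by split; exact: h.
Qed.

Variable L : R.
Hypothesis L0 : 0 <= L.

(** On [0, M] this is the integral of |q| + L from x to M, since [prim] carries a minus sign.
    Iterated integration produces its powers divided by factorials. *)
Definition weight x := L * (M - x) - prim M (fun t => `|q t|) x.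

Lemma weight_ac_derive : ac_derive weight (fun x => - (`|q x| + L)).
Proof.
have h : ac_derive (prim M (fun t => `|q t|)) (fun x => `|q x|).
  by apply: prim_ac_derive; [exact: integ_norm|move=> y My; rewrite q0// normr0].
apply: ac_derive_eq (ac_deriveD (ac_deriveZ L (ac_deriveD (ac_derive_cst M) (ac_deriveZ
  (- 1) (@ac_derive_id R)))) (ac_deriveZ (- 1) h)) _ _.
  by move=> x _; rewrite /weight !mulN1r.
by apply: aeW => x _; ring.
Qed.

Lemma weight_end : weight M = 0.
Proof. by rewrite /weight subrr mulr0 prim0// ?subr0//; exact: integ_norm. Qed.

Lemma weight_ge0 x : 0 <= x -> x <= M -> 0 <= weight x.
Proof.
move=> x0 xM; rewrite -oppr_le0 -[leRHS]oppr0 -weight_end.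
have := ac_derive_le (ac_deriveZ (- 1) weight_ac_derive) x0 xM; rewrite !mulN1r; apply => z _ _.
by rewrite mulN1r opprK addr_ge0.
Qed.

Lemma weight_le x : 0 <= x -> x <= M -> weight x <= weight 0.
Proof.
move=> x0 xM; rewrite -lerN2.
have := ac_derive_le (ac_deriveZ (- 1) weight_ac_derive) (lexx 0) x0; rewrite !mulN1r;
  apply => z _ _.
by rewrite mulN1r opprK addr_ge0.
Qed.

Lemma weight_exp_ac_derive n : ac_derive (fun x => weight x ^+ n.+1 / n.+1`!%:R)
  (fun x => - (`|q x| + L) * (weight x ^+ n / n`!%:R)).
Proof.
elim: n => [|n IH].
  apply: ac_derive_eq weight_ac_derive _ _ => [x _|]; first by rewrite expr1 divr1.
  by apply: aeW => x _; rewrite expr0 divr1 mulr1.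
have a0 : n.+2%:R != 0 :> R by rewrite pnatr_eq0.
have b0 : n.+1`!%:R != 0 :> R by rewrite pnatr_eq0 -lt0n fact_gt0.
have c0 : n`!%:R != 0 :> R by rewrite pnatr_eq0 -lt0n fact_gt0.
(* Writing n + 1 as (n + 2) - 1 leaves [field] a single symbol besides the factorial of n. *)
have bE : n.+1`!%:R = (n.+2%:R - 1) * n`!%:R :> R.
  by rewrite factS natrM -[n.+2%:R]natr1 addrK.
apply: ac_derive_eq (ac_deriveZ (n.+2%:R^-1) (ac_deriveM weight_ac_derive IH)) _ _ => [x _|].
  rewrite [n.+2`!]factS natrM [_ ^+ n.+2]exprS.
  by move: a0 b0; move: (n.+2%:R) (n.+1`!%:R) => a b a0 b0; field; rewrite a0 b0.
apply: aeW => x _; rewrite exprS.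
have d0 : n.+2%:R - 1 != 0 :> R by rewrite -[n.+2%:R]natr1 addrK pnatr_eq0.
rewrite bE {bE b0 IH}; move: a0 c0 d0; move: (n.+2%:R) (n`!%:R) => a b a0 b0 d0; field.
by rewrite ?a0 ?b0 ?d0.
Qed.

(** Comparison backwards from M: [f - w] and [- f - w] are nondecreasing up to M and at most 0
    there. *)
Lemma ac_derive_bound f phi (w psi : R -> R) x : ac_derive f phi -> ac_derive w psi ->
  0 <= x -> x <= M ->
  f M = 0 -> 0 <= w M -> (forall z, 0 < z -> z < M -> `|phi z| <= - psi z) -> `|f x| <= w x.
Proof.
move=> df dw x0 xM fM wM H; have dw' := ac_deriveZ (- 1) dw.
have h1 : f x + - 1 * w x <= f M + - 1 * w M.
  apply: (ac_derive_le (ac_deriveD df dw') x0 xM) => z xz zM.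
  by have := H z (le_lt_trans x0 xz) zM; rewrite ler_norml => /andP[+ _]; lra.
have h2 : - 1 * f x + - 1 * w x <= - 1 * f M + - 1 * w M.
  apply: (ac_derive_le (ac_deriveD (ac_deriveZ (- 1) df) dw') x0 xM) => z xz zM.
  by have := H z (le_lt_trans x0 xz) zM; rewrite ler_norml => /andP[_ +]; lra.
by rewrite ler_norml; apply/andP; split; lra.
Qed.

End picard_bound.

Lemma size1_bound (R : realFieldType) (Q A B w a c d t : R) : 0 <= w ->
  0 <= Q -> 0 <= A -> 0 <= B -> a <= w -> c <= w -> d <= w -> t <= A * c + B * d ->
  Q * a + t <= (Q + (1 + A + B)) * w.
Proof.
move=> w0 Q0 A0 B0 /(ler_wpM2l Q0) h1 /(ler_wpM2l A0) h2 /(ler_wpM2l B0) h3 h4; lra.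
Qed.

Lemma size1_ge1 (R : realFieldType) (Q A B : R) :
  0 <= Q -> 0 <= A -> 0 <= B -> 1 <= Q + (1 + A + B).
Proof. lra. Qed.

Section picard_sum.
Variables (R : realType) (M : R) (q : R -> R).
Hypothesis M0 : 0 < M.
Hypothesis iq : integ M q.
Hypothesis q0 : forall x, M < x -> q x = 0.
Notation mu := (@lebesgue_measure R).
Implicit Types (x y : R) (n j N : nat) (k : R[i]).

Notation mm n := (iter_mg M q n).1.
Notation gg n := (iter_mg M q n).2.

Definition pow_re k j : R := complex.Re (k ^+ j).
Definition pow_im k j : R := complex.Im (k ^+ j).

Lemma pow_reS k j :
  pow_re k j.+1 = complex.Re k * pow_re k j - complex.Im k * pow_im k j.
Proof. by rewrite /pow_re /pow_im exprS; case: k (k ^+ j) => a b [c d]. Qed.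

Lemma pow_imS k j :
  pow_im k j.+1 = complex.Re k * pow_im k j + complex.Im k * pow_re k j.
Proof. by rewrite /pow_re /pow_im exprS; case: k (k ^+ j) => a b [c d]. Qed.

Definition itma k n := lincomb (pow_re k) (mm n) n.
Definition itmb k n := lincomb (pow_im k) (mm n) n.
Definition itga k n := lincomb (pow_re k) (gg n) n.
Definition itgb k n := lincomb (pow_im k) (gg n) n.

(** Dominates the coefficients of the system other than q: the 1 serves m' = g, and the two absolute
    values serve kappa g, each part of which mixes both parts of g. *)
Definition size1 k : R := 1 + `|complex.Re k| + `|complex.Im k|.

Lemma size1_ge0 k : 0 <= size1 k.
Proof. by rewrite /size1 !addr_ge0. Qed.

Lemma ma_ac_derive k n : ac_derive (itma k n.+1) (itga k n).
Proof. exact: lincomb_m_ac_derive. Qed.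

Lemma mb_ac_derive k n : ac_derive (itmb k n.+1) (itgb k n).
Proof. exact: lincomb_m_ac_derive. Qed.

Lemma ga_ac_derive k n : ac_derive (itga k n.+1)
  (fun x => q x * itma k n x - (complex.Re k * itga k n x - complex.Im k * itgb k n x)).
Proof.
apply: ac_derive_eq (lincomb_g_ac_derive M0 iq q0 (pow_re k) n) _ _ => //.
apply: aeW => x _; congr (_ - _); rewrite /lincomb !mulr_sumr -sumrB.
by apply: eq_bigr => j _; rewrite /= pow_reS; ring.
Qed.

Lemma gb_ac_derive k n : ac_derive (itgb k n.+1)
  (fun x => q x * itmb k n x - (complex.Re k * itgb k n x + complex.Im k * itga k n x)).
Proof.
apply: ac_derive_eq (lincomb_g_ac_derive M0 iq q0 (pow_im k) n) _ _ => //.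
apply: aeW => x _; congr (_ - _); rewrite /lincomb !mulr_sumr -big_split.
by apply: eq_bigr => j _; rewrite /= pow_imS; ring.
Qed.

Lemma ma_end k n x : M <= x -> itma k n x = (n == 0)%:R /\ itga k n x = 0.
Proof.
move=> Mx; have [h1 h2] := lincomb_end M0 iq (pow_re k) n Mx; split=> //.
by rewrite /itma h1 /pow_re expr0 mulr1.
Qed.

Lemma mb_end k n x : M <= x -> itmb k n x = 0 /\ itgb k n x = 0.
Proof.
move=> Mx; have [h1 h2] := lincomb_end M0 iq (pow_im k) n Mx; split=> //.
by rewrite /itmb h1 /pow_im expr0 mulr0.
Qed.

Notation W k n x := (weight M q (size1 k) x ^+ n / n`!%:R).

(** One iteration integrates the bound for n against |q| + [size1 k], which is minus the derivative
    of the weight; the case n = 0 is the pair (1, 0). *)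
Lemma picard_le k n x : 0 <= x -> x <= M ->
  [/\ `|itma k n x| <= W k n x, `|itmb k n x| <= W k n x,
      `|itga k n x| <= W k n x & `|itgb k n x| <= W k n x].
Proof.
elim: n x => [|n IH] x x0 xM.
  rewrite expr0 divr1 /itma /itmb /itga /itgb /lincomb !big_ord1 /= /pow_re /pow_im !expr0.
  by rewrite !mulr1 !mulr0 normr0 normr1 lexx ler01.
have W0 z : 0 < z -> z < M -> 0 <= W k n z.
  move=> /ltW z0 /ltW zM; rewrite divr_ge0// exprn_ge0//.
  exact: (weight_ge0 iq q0 (size1_ge0 k)).
have dW := weight_exp_ac_derive iq q0 (size1 k) n.
have bound f phi : ac_derive f phi -> f M = 0 ->
    (forall z, 0 < z -> z < M -> `|phi z| <= (`|q z| + size1 k) * W k n z) ->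
      `|f x| <= W k n.+1 x.
  move=> df fM h; apply: (ac_derive_bound df dW x0 xM fM).
    by rewrite weight_end// expr0n mul0r.
  by move=> z z0 zM; rewrite mulNr opprK; exact: h.
split.
- apply: (bound _ _ (ma_ac_derive k n)); first by rewrite (ma_end k n.+1 (lexx M)).1.
  move=> z z0 zM; have [_ _ h _] := IH z (ltW z0) (ltW zM).
  by apply: le_trans h _; rewrite ler_peMl ?W0// size1_ge1.
- apply: (bound _ _ (mb_ac_derive k n)); first by rewrite (mb_end k n.+1 (lexx M)).1.
  move=> z z0 zM; have [_ _ _ h] := IH z (ltW z0) (ltW zM).
  by apply: le_trans h _; rewrite ler_peMl ?W0// size1_ge1.
- apply: (bound _ _ (ga_ac_derive k n)); first by rewrite (ma_end k n.+1 (lexx M)).2.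
  move=> z z0 zM; have [h1 h2 h3 h4] := IH z (ltW z0) (ltW zM).
  rewrite (le_trans (ler_normB _ _))// normrM.
  apply: (size1_bound (W0 z z0 zM) _ _ _ h1 h3 h4) => //.
  by rewrite -!normrM ler_normB.
- apply: (bound _ _ (gb_ac_derive k n)); first by rewrite (mb_end k n.+1 (lexx M)).2.
  move=> z z0 zM; have [h1 h2 h3 h4] := IH z (ltW z0) (ltW zM).
  rewrite (le_trans (ler_normB _ _))// normrM.
  apply: (size1_bound (W0 z z0 zM) _ _ _ h2 h4 h3) => //.
  by rewrite -!normrM ler_normD.
Qed.

Definition growth k := weight M q (size1 k) 0.

Lemma picard_le_exp k n x : 0 <= x ->
  [/\ `|itma k n x| <= exp_coeff (growth k) n, `|itmb k n x| <= exp_coeff (growth k) n,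
      `|itga k n x| <= exp_coeff (growth k) n & `|itgb k n x| <= exp_coeff (growth k) n].
Proof.
move=> x0; have g0 : 0 <= growth k.
  exact: (weight_ge0 iq q0 (size1_ge0 k) (lexx 0) (ltW M0)).
have [xM|/ltW Mx] := leP x M.
  have wle : W k n x <= exp_coeff (growth k) n.
    rewrite /exp_coeff /= ler_wpM2r ?invr_ge0// lerXn2r ?nnegrE//.
      exact: (weight_ge0 iq q0 (size1_ge0 k)).
    exact: (weight_le iq q0 (size1_ge0 k)).
  by have [h1 h2 h3 h4] := picard_le k n x0 xM; split; exact: le_trans wle.
have [-> ->] := ma_end k n Mx; have [-> ->] := mb_end k n Mx.
have e0 : 0 <= exp_coeff (growth k) n by rewrite exp_coeff_ge0.
rewrite normr0; split=> //; case: n e0 => [|n] e0; last by rewrite normr0.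
by rewrite /exp_coeff /= expr0 normr1 divr1.
Qed.

Definition exp_tail k N := expR (growth k) - series (exp_coeff (growth k)) N.

Lemma tail_cvg k : exp_tail k N @[N --> \oo] --> 0.
Proof.
have c : series (exp_coeff (growth k)) @ \oo --> expR (growth k).
  exact: is_cvg_series_exp_coeff.
have := @cvgB _ _ _ _ _ _ _ _ _ (@cvg_cst _ (expR (growth k)) _ \oo _) c.
by rewrite subrr; apply.
Qed.

Lemma tail_decr k N : exp_tail k N.+1 <= exp_tail k N.
Proof.
rewrite /exp_tail lerD2l lerN2 seriesSr lerDl exp_coeff_ge0//.
exact: (weight_ge0 iq q0 (size1_ge0 k) (lexx 0) (ltW M0)).
Qed.

Definition psum (f : R[i] -> nat -> R -> R) k x := limn (series (fun n => f k n x)).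

Lemma psum_tail k (f : R[i] -> nat -> R -> R) x :
  (forall n, `|f k n x| <= exp_coeff (growth k) n) ->
  cvgn (series (fun n => f k n x)) /\
  forall N, `|psum f k x - series (fun n => f k n x) N| <= exp_tail k N.
Proof.
move=> /series_tail h; have [h1 h2] := h (is_cvg_series_exp_coeff _).
split=> // N; exact: h2.
Qed.

End picard_sum.

(** * The sum of the iterates solves the system *)

Section jost_system.
Variables (R : realType) (M : R) (q : R -> R).
Hypothesis M0 : 0 < M.
Hypothesis iq : integ M q.
Hypothesis q0 : forall x, M < x -> q x = 0.
Notation mu := (@lebesgue_measure R).
Implicit Types (x y : R) (n j N : nat) (k : R[i]).

Notation ma := (itma M q).
Notation mb := (itmb M q).
Notation ga := (itga M q).
Notation gb := (itgb M q).
Notation tail := (exp_tail M q).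

Lemma tail_squeeze k (a c : R) : (forall N, `|a| <= c * tail k N) -> a = 0.
Proof.
move=> h; apply/eqP; rewrite -normr_le0.
have cc : c * tail k N @[N --> \oo] --> c * 0 by apply: cvgMr; exact: tail_cvg.
rewrite -(mulr0 c) -(cvg_lim _ cc)//; apply: limr_ge.
  by apply/cvg_ex; eexists; exact: cc.
exact: nearW.
Qed.

Lemma tail_ge0 k N : 0 <= tail k N.
Proof.
have h n : `|exp_coeff (growth M q k) n| <= exp_coeff (growth M q k) n.
  rewrite ger0_norm// exp_coeff_ge0//.
  exact: (weight_ge0 iq q0 (size1_ge0 k) (lexx 0) (ltW M0)).
have [_ {}h] := psum_tail (f := fun _ n _ => exp_coeff (growth M q k) n) (x := 0) h.
exact: le_trans (h N).
Qed.

Lemma psum_ma k x : 0 <= x -> forall N,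
  `|psum ma k x - series (fun n => ma k n x) N| <= tail k N.
Proof.
move=> x0; have h n := let: And4 h _ _ _ := picard_le_exp M0 iq q0 k n x0 in h.
by have [] := psum_tail h.
Qed.

Lemma psum_mb k x : 0 <= x -> forall N,
  `|psum mb k x - series (fun n => mb k n x) N| <= tail k N.
Proof.
move=> x0; have h n := let: And4 _ h _ _ := picard_le_exp M0 iq q0 k n x0 in h.
by have [] := psum_tail h.
Qed.

Lemma psum_ga k x : 0 <= x -> forall N,
  `|psum ga k x - series (fun n => ga k n x) N| <= tail k N.
Proof.
move=> x0; have h n := let: And4 _ _ h _ := picard_le_exp M0 iq q0 k n x0 in h.
by have [] := psum_tail h.
Qed.

Lemma psum_gb k x : 0 <= x -> forall N,
  `|psum gb k x - series (fun n => gb k n x) N| <= tail k N.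
Proof.
move=> x0; have h n := let: And4 _ _ _ h := picard_le_exp M0 iq q0 k n x0 in h.
by have [] := psum_tail h.
Qed.

Lemma psum_bmeas k (f : R[i] -> nat -> R -> R) : (forall n, bmeas M (f k n)) ->
  (forall x n, 0 <= x -> `|f k n x| <= exp_coeff (growth M q k) n) -> bmeas M (psum f k).
Proof.
move=> fn fe; split; last first.
  exists (tail k 0) => x x0 _; have [_ h] := psum_tail (fun n => fe x n x0).
  by have := h 0; rewrite seriesEnat/= big_geq// subr0.
apply: (measurable_fun_cvg (h := fun N x => series (fun n => f k n x) N)).
  by move=> N; apply: measurable_sum => n; exact: (fn n).1.
move=> x /=; rewrite in_itv/= => /andP[x0 _].
by have [] := psum_tail (fun n => fe x n x0).
Qed.

(** The zeroth term is constant, so differentiating N + 1 terms of one series leaves N terms of the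
    other. *)
Lemma ac_derive_series (u p : nat -> R -> R) N c : (forall x, u 0 x = c) ->
  (forall n, ac_derive (u n.+1) (p n)) ->
  ac_derive (fun x => series (fun n => u n x) N.+1) (fun x => series (fun n => p n x) N).
Proof.
move=> u0 up; elim: N => [|N IH].
  apply: ac_derive_eq (ac_derive_cst c) _ _ => [x _|].
    by rewrite seriesEnat/= big_nat1.
  by apply: aeW => x _; rewrite seriesEnat/= big_geq.
apply: ac_derive_eq (ac_deriveD IH (up N)) _ _ => [x _|].
  by rewrite !seriesEnat/= [RHS]big_nat_recr.
by apply: aeW => x _; rewrite !seriesEnat/= [RHS]big_nat_recr.
Qed.

(** The partial sum with N + 1 terms minus [c + prim M phi] vanishes at M, and its derivative is at
    most [tail k N] times minus the derivative of the weight; by comparison it is at most [tail k N]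
    times the weight. Letting N grow gives the integral equation for the limit. *)
Lemma ac_derive_limit k (u p : nat -> R -> R) (F phi : R -> R) c x :
  (forall x, u 0 x = c) -> (forall n, ac_derive (u n.+1) (p n)) ->
  (forall n, u n.+1 M = 0) -> integ M phi -> (forall y, M < y -> phi y = 0) ->
  (forall N z, 0 < z -> z < M ->
     `|series (fun n => p n z) N - phi z| <= (`|q z| + size1 k) * tail k N) ->
  0 <= x -> x <= M -> (forall N, `|F x - series (fun n => u n x) N| <= tail k N) ->
  F x = c + prim M phi x.
Proof.
move=> u0 up uM iphi phi0 pphi x0 xM FP.
(* The 1 pays for truncating the series, the weight for the comparison of derivatives. *)
apply/eqP; rewrite -subr_eq0; apply/eqP; apply: (@tail_squeeze k _ (1 + weight M q
  (size1 k) x)).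
move=> N; rewrite mulrDl mul1r.
have seM : series (fun n => u n M) N.+1 = c.
  by rewrite seriesEnat/= big_nat_recl//= u0 big1 ?addr0// => i _; exact: uM.
have dF : ac_derive (fun x => series (fun n => u n x) N.+1 + (-1) * (c + prim M phi x))
    (fun x => series (fun n => p n x) N + (-1) * (0 + phi x)).
  apply: ac_deriveD; first exact: ac_derive_series u0 up.
  by apply: ac_deriveZ; apply: ac_deriveD; [exact: ac_derive_cst|exact: prim_ac_derive].
have := ac_derive_bound dF (ac_deriveZ (tail k N) (weight_ac_derive iq q0 (size1 k))) x0 xM.
rewrite seM prim0// weight_end// !mulr0 addr0 mulN1r subrr => /(_ erefl (lexx 0)) h.
have {}h : `|series (fun n => u n x) N.+1 + -1 *
  (c + prim M phi x)| <= tail k N * weight M q (size1 k) x.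
  apply: h => z z0 zM; rewrite add0r mulN1r mulrN opprK mulrC; exact: pphi.
rewrite (_ : _ - _ = (F x - series (fun n => u n x) N.+1) +
   (series (fun n => u n x) N.+1 + -1 * (c + prim M phi x))); last by ring.
rewrite (le_trans (ler_normD _ _))// [_ * tail k N]mulrC lerD//.
by rewrite (le_trans (FP _))// tail_decr.
Qed.

Lemma psum_end k x : M <= x -> [/\ psum ma k x = 1, psum mb k x = 0,
  psum ga k x = 0 & psum gb k x = 0].
Proof.
move=> Mx; have x0 := le_trans (ltW M0) Mx.
have z f : (forall N, `|psum f k x - series (fun n => f k n x) N| <= tail k N) ->
    (forall n, f k n.+1 x = 0) -> psum f k x = f k 0 x.
  move=> h fz; apply/eqP; rewrite -subr_eq0; apply/eqP.
  apply: (@tail_squeeze k _ 1) => N; rewrite mul1r; apply: le_trans (tail_decr M0 iq q0 k N).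
  have := h N.+1; rewrite seriesEnat/= big_nat_recl//= big1 ?addr0// => i _; exact: fz.
have ae n := ma_end M0 iq k n Mx; have be n := mb_end M0 iq k n Mx.
split.
- by rewrite z ?(ae 0).1// => [|n]; [exact: psum_ma|rewrite (ae _).1].
- by rewrite z ?(be 0).1// => [|n]; [exact: psum_mb|rewrite (be _).1].
- by rewrite z ?(ae 0).2// => [|n]; [exact: psum_ga|rewrite (ae _).2].
- by rewrite z ?(be 0).2// => [|n]; [exact: psum_gb|rewrite (be _).2].
Qed.

Lemma psums_bmeas k : [/\ bmeas M (psum ma k), bmeas M (psum mb k), bmeas M
  (psum ga k) & bmeas M (psum gb k)].
Proof.
by split; apply: psum_bmeas => [n|x n x0]; try (by have [] := picard_le_exp M0 iq q0 k n x0);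
  have [h1 h2] := lincomb_bmeas M0 iq (pow_re k) n;
    have [h3 h4] := lincomb_bmeas M0 iq (pow_im k) n.
Qed.

Definition dga k x := q x * psum ma k x -
  (complex.Re k * psum ga k x - complex.Im k * psum gb k x).
Definition dgb k x := q x * psum mb k x -
  (complex.Re k * psum gb k x + complex.Im k * psum ga k x).

Lemma dg_integ k : integ M (dga k) /\ integ M (dgb k).
Proof.
have [h1 h2 h3 h4] := psums_bmeas k.
have E1 : dga k = (fun x => q x * psum ma k x +
  ((- complex.Re k) * psum ga k x + complex.Im k * psum gb k x)).
  by apply/funext => x; rewrite /dga; ring.
have E2 : dgb k = (fun x => q x * psum mb k x + ((- complex.Re k) * psum gb k x +
  (- complex.Im k) * psum ga k x)).
  by apply/funext => x; rewrite /dgb; ring.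
by rewrite E1 E2; split; apply: integD; do ?[exact: integ_mul|apply: integD|apply: integZ;
  exact: bmeas_integ].
Qed.

Lemma dg_end k x : M < x -> dga k x = 0 /\ dgb k x = 0.
Proof.
move=> Mx; have [_ _ e1 e2] := psum_end k (ltW Mx).
by rewrite /dga /dgb q0// e1 e2 !mulr0 !mul0r; split; rewrite ?addr0 !subr0.
Qed.

Lemma psum_eq k x : 0 <= x ->
  [/\ psum ma k x = 1 + prim M (psum ga k) x, psum mb k x = prim M (psum gb k) x,
   psum ga k x = prim M (dga k) x & psum gb k x = prim M (dgb k) x].
Proof.
move=> x0; have [n1 n2 n3 n4] := psums_bmeas k; have [i1 i2] := dg_integ k.
have [Mx|/ltW xM] := leP M x.
  have [-> -> -> ->] := psum_end k Mx; rewrite !prim0 ?addr0//; exact: bmeas_integ.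
have T z N : 0 <= z -> `|series (fun n => ma k n z) N - psum ma k z| <= tail k N /\
   `|series (fun n => mb k n z) N - psum mb k z| <= tail k N /\
   `|series (fun n => ga k n z) N - psum ga k z| <= tail k N /\
   `|series (fun n => gb k n z) N - psum gb k z| <= tail k N.
  move=> z0; rewrite distrC psum_ma// distrC psum_mb// distrC psum_ga// distrC.
  by rewrite psum_gb.
have pe y : M < y -> psum ga k y = 0 /\ psum gb k y = 0.
  by move=> /ltW /(psum_end k)[].
have big f N z : `|f| <= tail k N -> `|f| <= (`|q z| + size1 k) * tail k N.
  by move=> /le_trans; apply; rewrite ler_peMl ?tail_ge0// size1_ge1.
split.
- apply: (@ac_derive_limit k (ma k) (ga k)) => //.
  + by move=> y; rewrite /itma /lincomb big_ord1 /= /pow_re expr0 mulr1.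
  + by move=> n; exact: ma_ac_derive.
  + by move=> n; rewrite (ma_end M0 iq k n.+1 (lexx M)).1.
  + exact: bmeas_integ.
  + by move=> y /pe[].
  + by move=> N z z0 zM; apply: big; have [_ [_ [h _]]] := T z N (ltW z0).
  + exact: psum_ma.
- rewrite -[RHS]add0r; apply: (@ac_derive_limit k (mb k) (gb k)) => //.
  + by move=> y; rewrite /itmb /lincomb big_ord1 /= /pow_im expr0 mul0r.
  + by move=> n; exact: mb_ac_derive.
  + by move=> n; rewrite (mb_end M0 iq k n.+1 (lexx M)).1.
  + exact: bmeas_integ.
  + by move=> y /pe[].
  + by move=> N z z0 zM; apply: big; have [_ [_ [_ h]]] := T z N (ltW z0).
  + exact: psum_mb.
- rewrite -[RHS]add0r; apply: (@ac_derive_limit k (ga k) _ _ _ _ _ _ (fun n =>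
  ga_ac_derive M0 iq q0 k n)) => //.
  + by move=> y; rewrite /itga /lincomb big_ord1 /= mulr0.
  + by move=> n; rewrite (ma_end M0 iq k n.+1 (lexx M)).2.
  + by move=> y /(dg_end k)[].
  + move=> N z z0 zM; have [h1 [h2 [h3 h4]]] := T z N (ltW z0).
    rewrite [X in `|X|](_ : _ = q z * (series (fun n => ma k n z) N - psum ma k z) +
       (complex.Im k * (series (fun n => gb k n z) N - psum gb k z) -
        complex.Re k * (series (fun n => ga k n z) N - psum ga k z))).
      rewrite (le_trans (ler_normD _ _))// normrM;
        apply: (size1_bound (tail_ge0 k N) _ _ _ h1 h3 h4) => //.
      by rewrite (le_trans (ler_normB _ _))// !normrM addrC.
    rewrite /dga !seriesEnat/= sumrB sumrB -!mulr_sumr; ring.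
  + exact: psum_ga.
- rewrite -[RHS]add0r; apply: (@ac_derive_limit k (gb k) _ _ _ _ _ _ (fun n =>
  gb_ac_derive M0 iq q0 k n)) => //.
  + by move=> y; rewrite /itgb /lincomb big_ord1 /= mulr0.
  + by move=> n; rewrite (mb_end M0 iq k n.+1 (lexx M)).2.
  + by move=> y /(dg_end k)[].
  + move=> N z z0 zM; have [h1 [h2 [h3 h4]]] := T z N (ltW z0).
    rewrite [X in `|X|](_ : _ = q z * (series (fun n => mb k n z) N - psum mb k z) -
       (complex.Re k * (series (fun n => gb k n z) N - psum gb k z) +
        complex.Im k * (series (fun n => ga k n z) N - psum ga k z))).
      rewrite (le_trans (ler_normB _ _))// normrM;
        apply: (size1_bound (tail_ge0 k N) _ _ _ h2 h4 h3) => //.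
      by rewrite (le_trans (ler_normD _ _))// !normrM.
    rewrite /dgb !seriesEnat/= sumrB big_split/= -!mulr_sumr; ring.
  + exact: psum_gb.
Qed.

(** Here and in [jost_sys_bound], [k] stands for 2 i times the spectral parameter, with m = A + i B
    and g = C + i D. *)
Definition jost_sys k (A B C D : R -> R) := [/\ ac_derive A C, ac_derive B D,
  ac_derive C (fun x => q x * A x - (complex.Re k * C x - complex.Im k * D x)),
  ac_derive D (fun x => q x * B x - (complex.Re k * D x + complex.Im k * C x)) &
  forall x, M <= x -> [/\ A x = 1, B x = 0, C x = 0 & D x = 0]].

Lemma jost_sys_psum k : jost_sys k (psum ma k) (psum mb k) (psum ga k) (psum gb k).
Proof.
have [n1 n2 n3 n4] := psums_bmeas k; have [i1 i2] := dg_integ k.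
split; last by move=> x /(psum_end k).
- apply: ac_derive_eq (ac_deriveD (ac_derive_cst 1) (prim_ac_derive
  (bmeas_integ M0 n3) _)) _ _ => [y /ltW/(psum_end k)[]//|x x0|].
    by have [-> _ _ _] := psum_eq k x0.
  by apply: aeW => x _; rewrite add0r.
- apply: ac_derive_eq (prim_ac_derive (bmeas_integ M0 n4) _) _ _ =>
  [y /ltW/(psum_end k)[]//|x x0|].
    by have [_ -> _ _] := psum_eq k x0.
  exact: aeW.
- apply: ac_derive_eq (prim_ac_derive i1 _) _ _ => [y /(dg_end k)[]//|x x0|].
    by have [_ _ -> _] := psum_eq k x0.
  exact: aeW.
- apply: ac_derive_eq (prim_ac_derive i2 _) _ _ => [y /(dg_end k)[]//|x x0|].
    by have [_ _ _ ->] := psum_eq k x0.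
  exact: aeW.
Qed.

(** Each part of g is itself a primitive, hence continuous, so m' = g holds at every x > 0. *)
Lemma psum_derive k x : 0 < x ->
  is_derive x 1 (psum ma k) (psum ga k x) /\ is_derive x 1 (psum mb k) (psum gb k x).
Proof.
move=> x0; have [n1 n2 n3 n4] := psums_bmeas k; have [i1 i2] := dg_integ k.
have c (f g : R -> R) : (forall y, 0 <= y -> f y = prim M g y) -> integ M g ->
  {for x, continuous f}.
  move=> fg ig; have cg : {for x, continuous (prim M g)} by exact: prim_continuous.
  move: cg; rewrite /prop_for /continuous_at fg ?ltW//; apply: cvg_trans; apply: near_eq_cvg.
  by near=> y; rewrite fg//; apply/ltW; near: y; exact: lt_nbhsr.
have ca : {for x, continuous (psum ga k)}.
  by apply: c i1 => y y0; have [_ _ ->] := psum_eq k y0.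
have cb : {for x, continuous (psum gb k)}.
  by apply: c i2 => y y0; have [_ _ _ ->] := psum_eq k y0.
have da := prim_derive (bmeas_integ M0 n3) (fun y My =>
  let: And4 _ _ h _ := psum_end k (ltW My) in h) x0 ca.
have db := prim_derive (bmeas_integ M0 n4) (fun y My =>
  let: And4 _ _ _ h := psum_end k (ltW My) in h) x0 cb.
split; last first.
  apply: near_eq_is_derive db; near=> y.
  have [|_ -> _ _//] := @psum_eq k y; apply/ltW; near: y; exact: lt_nbhsr.
have da1 : is_derive x 1 (cst (1 : R) + prim M (psum ga k)) (psum ga k x).
  by rewrite -[X in is_derive _ _ _ X]add0r; apply: is_deriveD.
apply: near_eq_is_derive da1; near=> y.
have [|-> _ _ _//] := @psum_eq k y; apply/ltW; near: y; exact: lt_nbhsr.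
Unshelve. all: by end_near. Qed.

End jost_system.

(** * The Jost function *)

Lemma cmod_ge_Re (R : realType) (z : R[i]) : `|complex.Re z| <= cmod z.
Proof.
by case: z => a b; rewrite /cmod /= -sqrtr_sqr ler_wsqrtr// lerDl sqr_ge0.
Qed.

Lemma cmod_ge_Im (R : realType) (z : R[i]) : `|complex.Im z| <= cmod z.
Proof.
by case: z => a b; rewrite /cmod /= -sqrtr_sqr ler_wsqrtr// lerDr sqr_ge0.
Qed.

Lemma cmod_le_ReIm (R : realType) (z : R[i]) : cmod z <= `|complex.Re z| + `|complex.Im z|.
Proof.
case: z => a b; rewrite /cmod /=.
rewrite -[leRHS]ger0_norm ?addr_ge0// -sqrtr_sqr ler_wsqrtr//.
rewrite -[in leLHS](real_normK (num_real a)) -[in leLHS](real_normK (num_real b)).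
by have := mulr_ge0 (normr_ge0 a) (normr_ge0 b); lra.
Qed.

Section solutions.
Variable R : realType.
Notation mu := (@lebesgue_measure R).
Implicit Types (x y : R) (k : R[i]) (f g phi psi : R -> R).

Lemma loc_abs_continuousP (f : R -> R[i]) : loc_abs_continuous f <->
  forall b, 0 < b -> AC 0 b (fun x => complex.Re (f x)) /\ AC 0 b (fun x => complex.Im (f x)).
Proof.
split=> [h b b0|h b b0 e e0].
  split=> e e0; have [d d0 dP] := h b b0 e e0; exists d => // s [s1 s2] sd;
    apply: le_lt_trans (dP s s1 s2 sd); apply: ler_sum => p _.
    by rewrite -raddfB cmod_ge_Re.
  by rewrite -raddfB cmod_ge_Im.
have [h1 h2] := h b b0; have e2 : 0 < e / 2 by lra.
have [d d0 dP] := h1 _ e2; have [d' d'0 d'P] := h2 _ e2.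
exists (Num.min d d'); first by rewrite lt_min d0.
move=> s s1 s2; rewrite lt_min => /andP[sd sd'].
have ss : subdiv 0 b s by [].
apply: (@le_lt_trans _ _ (\sum_(p <- s) `|complex.Re (f p.2) - complex.Re (f p.1)| +
   \sum_(p <- s) `|complex.Im (f p.2) - complex.Im (f p.1)|)).
  rewrite -big_split/=; apply: ler_sum => p _.
  by rewrite -!raddfB cmod_le_ReIm.
by have := dP s ss sd; have := d'P s ss sd'; lra.
Qed.

Lemma derive_mul f g x (a b : R) : is_derive x 1 f a -> is_derive x 1 g b ->
  is_derive x 1 (fun x => f x * g x) (a * g x + f x * b).
Proof.
move=> df dg; rewrite (_ : _ + _ = f x *: b + g x *: a); first exact: is_deriveM.
by rewrite addrC [a * _]mulrC.
Qed.

Lemma derive_add f g x (a b : R) : is_derive x 1 f a -> is_derive x 1 g b ->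
  is_derive x 1 (fun x => f x + g x) (a + b).
Proof. by move=> df dg; exact: is_deriveD. Qed.

Lemma derive_sub f g x (a b : R) : is_derive x 1 f a -> is_derive x 1 g b ->
  is_derive x 1 (fun x => f x - g x) (a - b).
Proof. by move=> df dg; exact: is_deriveB. Qed.

Lemma ac_deriveB f g phi psi : ac_derive f phi -> ac_derive g psi ->
  ac_derive (fun x => f x - g x) (fun x => phi x - psi x).
Proof.
move=> df dg; apply: ac_derive_eq (ac_deriveD df (ac_deriveZ (- 1) dg)) _ _ => [x _|].
  by rewrite mulN1r.
by apply: aeW => x _; rewrite mulN1r.
Qed.

Lemma ac_derive_lipschitz f phi (K : R) : (forall x, is_derive x 1 f (phi x)) ->
  (forall x, `|phi x| <= K) -> ac_derive f phi.
Proof.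
move=> df pK; split=> [b b0|]; last exact: aeW.
apply: (AC_dominated (K := K) (@AC_id R 0 b) (@AC_cst R 0 b 0)) => x y x0 xy yb.
rewrite subrr normr0 addr0.
have [c _ ->] := @MVT_segment R f phi x y xy (fun z _ =>
  df z) (derivable_within_continuous (fun z _ => @ex_derive _ _ _ _ _ _ _ (df z))).
by rewrite normrM ler_wpM2r.
Qed.

Definition ecos k x : R := expR (- complex.Im k * x) * cos (complex.Re k * x).
Definition esin k x : R := expR (- complex.Im k * x) * sin (complex.Re k * x).

Lemma linear_derive (c : R) x : is_derive x 1 (fun t => c * t) c.
Proof.
have := derive_mul (is_derive_cst c x 1) (is_derive_id x 1).
by rewrite mul0r add0r mulr1.
Qed.

Lemma cos_derive (c x : R) : is_derive x 1 (fun t => cos (c * t)) (- c * sin (c * x)).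
Proof.
rewrite mulNr mulrC -mulNr.
exact: (is_derive1_comp (f := cos) (is_derive_cos (c * x)) (linear_derive c x)).
Qed.

Lemma sin_derive (c x : R) : is_derive x 1 (fun t => sin (c * t)) (c * cos (c * x)).
Proof.
rewrite mulrC; exact: (is_derive1_comp (f := sin) (is_derive_sin (c * x)) (linear_derive c x)).
Qed.

Lemma expc_derive (c x : R) : is_derive x 1 (fun t => expR (c * t)) (c * expR (c * x)).
Proof.
rewrite mulrC; exact: (is_derive1_comp (f := expR) (is_derive_expR (c * x))
  (linear_derive c x)).
Qed.

Definition decos k x := - complex.Im k * ecos k x - complex.Re k * esin k x.
Definition desin k x := - complex.Im k * esin k x + complex.Re k * ecos k x.

Lemma ecos_derive k x : is_derive x 1 (ecos k) (decos k x).
Proof.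
have := derive_mul (expc_derive (- complex.Im k) x) (cos_derive (complex.Re k) x).
by congr (is_derive _ _ _ _); rewrite /decos /ecos /esin; ring.
Qed.

Lemma esin_derive k x : is_derive x 1 (esin k) (desin k x).
Proof.
have := derive_mul (expc_derive (- complex.Im k) x) (sin_derive (complex.Re k) x).
by congr (is_derive _ _ _ _); rewrite /desin /ecos /esin; ring.
Qed.

Lemma exp_ac_derive (c : R) : ac_derive (fun x => expR (c * x)) (fun x => c * expR (c * x)).
Proof.
apply: ac_derive_eq (ac_derive_exp (ac_deriveZ c (@ac_derive_id R))) _ _ => //.
by apply: aeW => x _; rewrite mulr1.
Qed.

Lemma ecos_ac_derive k : ac_derive (ecos k) (decos k).
Proof.
have dc : ac_derive (fun x => cos (complex.Re k * x)) (fun x =>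
  - complex.Re k * sin (complex.Re k * x)).
  apply: (ac_derive_lipschitz (K := `|complex.Re k|)) => x; first exact: cos_derive.
  by rewrite normrM normrN ler_piMr// ler_norml sin_geN1 sin_le1.
apply: ac_derive_eq (ac_deriveM (exp_ac_derive (- complex.Im k)) dc) _ _ => //.
by apply: aeW => x _; rewrite /decos /ecos /esin; ring.
Qed.

Lemma esin_ac_derive k : ac_derive (esin k) (desin k).
Proof.
have dc : ac_derive (fun x => sin (complex.Re k * x)) (fun x =>
  complex.Re k * cos (complex.Re k * x)).
  apply: (ac_derive_lipschitz (K := `|complex.Re k|)) => x; first exact: sin_derive.
  by rewrite normrM ler_piMr// ler_norml cos_geN1 cos_le1.
apply: ac_derive_eq (ac_deriveM (exp_ac_derive (- complex.Im k)) dc) _ _ => //.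
by apply: aeW => x _; rewrite /desin /ecos /esin; ring.
Qed.

Lemma cexp_ikx k x : cexp ('i * k * x%:C) = ecos k x +i* esin k x.
Proof.
rewrite /cexp /ecos /esin; case: k => u v.
have -> : 'i * (u +i* v) * x%:C = (- v * x) +i* (u * x).
  by apply/eqP; rewrite eq_complex /=; apply/andP; split; apply/eqP; simpl; ring.
rewrite /=.
by apply/eqP; rewrite eq_complex /=; apply/andP; split; apply/eqP; simpl; ring.
Qed.

End solutions.

Lemma norm_mul_ge0 (R : realDomainType) (x t S : R) :
  - S <= t -> t <= S -> 0 <= `|x| * S + x * t.
Proof. by move=> h1 h2; case: (ger0P x) => x0; nra. Qed.

(** Gronwall's hypothesis for the energy |psi|^2 + |psi'|^2, with psi = a + i b, psi' = c + i d and
    k^2 = p + i r. Each contribution to its derivative is at most its coefficient in absolute value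
    times the energy, by 2 |x y| <= x^2 + y^2. *)
Lemma energy_ge0 (R : realFieldType) (a b c d Q p r : R) :
  0 <= c * a + a * c + (d * b + b * d) +
    (((Q - p) * a + r * b) * c + c * ((Q - p) * a + r * b) +
     (((Q - p) * b - r * a) * d + d * ((Q - p) * b - r * a))) +
    (`|Q| + (1 + `|p| + `|r|)) * (a * a + b * b + (c * c + d * d)).
Proof.
pose S := a * a + b * b + (c * c + d * d).
have h1 := sqr_ge0 (a + c); have h2 := sqr_ge0 (b + d).
have h3 := sqr_ge0 (a - c); have h4 := sqr_ge0 (b - d).
have h5 := sqr_ge0 (b + c); have h6 := sqr_ge0 (a + d).
have h7 := sqr_ge0 (b - c); have h8 := sqr_ge0 (a - d).
have e1 : 0 <= `|Q| * S + Q * (2 * (a * c + b * d)) by apply: norm_mul_ge0; rewrite /S; lra.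
have e2 : 0 <= `|p| * S + p * (- 2 * (a * c + b * d)) by apply: norm_mul_ge0; rewrite /S; lra.
have e3 : 0 <= `|r| * S + r * (2 * (b * c - a * d)) by apply: norm_mul_ge0; rewrite /S; lra.
move: e1 e2 e3; rewrite /S; lra.
Qed.

(** * Existence and uniqueness of the Jost solution *)

Section jost_solution.
Variables (R : realType) (M : R) (q q' : R -> R).
Hypothesis M0 : 0 < M.
Hypothesis iq : integ M q.
Hypothesis q0 : forall x, M < x -> q x = 0.
Notation mu := (@lebesgue_measure R).
Hypothesis qq' : {ae mu, forall x, 0 < x -> q' x = q x}.
Implicit Types (x y : R) (k : R[i]).

(** The number 2 i k, which is the coefficient of m' once e^(ikx) is factored out of the
    equation. *)
Definition kap k : R[i] := (- 2 * complex.Im k) +i* (2 * complex.Re k).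

Definition mre k := psum (itma M q) (kap k).
Definition mim k := psum (itmb M q) (kap k).
Definition gre k := psum (itga M q) (kap k).
Definition gim k := psum (itgb M q) (kap k).

Let u k := complex.Re k.
Let v k := complex.Im k.

Definition psir k x := ecos k x * mre k x - esin k x * mim k x.
Definition psii k x := ecos k x * mim k x + esin k x * mre k x.
(** With [dim], the two parts of i k m + g, so that psi' = e^(ikx) (i k m + g). *)
Definition dre k x := - v k * mre k x - u k * mim k x + gre k x.
Definition dim k x := - v k * mim k x + u k * mre k x + gim k x.
Definition dpsir k x := ecos k x * dre k x - esin k x * dim k x.
Definition dpsii k x := ecos k x * dim k x + esin k x * dre k x.

Lemma psir_ac_derive k : ac_derive (psir k) (dpsir k).
Proof.
have [dA dB dC dD _] := jost_sys_psum M0 iq q0 (kap k).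
apply: ac_derive_eq (ac_deriveB (ac_deriveM (ecos_ac_derive k) dA) (ac_deriveM
  (esin_ac_derive k) dB)) _ _ => //.
by apply: aeW => x _; rewrite /dpsir /dre /dim /decos /desin -/(u k) -/(v k) /mre /mim /gre
  /gim; ring.
Qed.

Lemma psii_ac_derive k : ac_derive (psii k) (dpsii k).
Proof.
have [dA dB dC dD _] := jost_sys_psum M0 iq q0 (kap k).
apply: ac_derive_eq (ac_deriveD (ac_deriveM (ecos_ac_derive k) dB) (ac_deriveM
  (esin_ac_derive k) dA)) _ _ => //.
by apply: aeW => x _; rewrite /dpsii /dre /dim /decos /desin -/(u k) -/(v k) /mre /mim /gre
  /gim; ring.
Qed.

Lemma psir_derive k x : 0 < x -> is_derive x 1 (psir k) (dpsir k x).
Proof.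
move=> x0; have [dA dB] := psum_derive M0 iq q0 (kap k) x0.
have := derive_sub (derive_mul (ecos_derive k x) dA) (derive_mul (esin_derive k x) dB).
by congr (is_derive _ _ _ _); rewrite /dpsir /dre /dim /decos /desin -/(u k) -/(v k) /mre
  /mim /gre /gim; ring.
Qed.

Lemma psii_derive k x : 0 < x -> is_derive x 1 (psii k) (dpsii k x).
Proof.
move=> x0; have [dA dB] := psum_derive M0 iq q0 (kap k) x0.
have := derive_add (derive_mul (ecos_derive k x) dB) (derive_mul (esin_derive k x) dA).
by congr (is_derive _ _ _ _); rewrite /dpsii /dre /dim /decos /desin -/(u k) -/(v k) /mre
  /mim /gre /gim; ring.
Qed.

(* With w = k ^+ 2, the real and imaginary parts of (Q - w) (a + i b). *)
Definition potre k (Q a b : R) := (Q - (u k ^+ 2 - v k ^+ 2)) * a + 2 * u k * v k * b.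
Definition potim k (Q a b : R) := (Q - (u k ^+ 2 - v k ^+ 2)) * b - 2 * u k * v k * a.

Lemma dre_ac_derive k : ac_derive (dre k) (fun x => - v k * gre k x - u k * gim k x +
   (q x * mre k x - (- 2 * v k * gre k x - 2 * u k * gim k x))).
Proof.
have [dA dB dC dD _] := jost_sys_psum M0 iq q0 (kap k).
exact: (ac_deriveD (ac_deriveB (ac_deriveZ (- v k) dA) (ac_deriveZ (u k) dB)) dC).
Qed.

Lemma dim_ac_derive k : ac_derive (dim k) (fun x => - v k * gim k x + u k * gre k x +
   (q x * mim k x - (- 2 * v k * gim k x + 2 * u k * gre k x))).
Proof.
have [dA dB dC dD _] := jost_sys_psum M0 iq q0 (kap k).
exact: (ac_deriveD (ac_deriveD (ac_deriveZ (- v k) dB) (ac_deriveZ (u k) dA)) dD).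
Qed.

Lemma dpsir_ac_derive k : ac_derive (dpsir k) (fun x => potre k (q x) (psir k x) (psii k x)).
Proof.
apply: ac_derive_eq (ac_deriveB (ac_deriveM (ecos_ac_derive k) (dre_ac_derive k))
  (ac_deriveM (esin_ac_derive k) (dim_ac_derive k))) _ _ => //.
apply: aeW => x _; rewrite /potre /psir /psii /dre /dim /decos /desin -/(u k) -/(v k).
by move: (ecos k x) (esin k x) (mre k x) (mim k x) (gre k x) (gim k x) (q x) => *; ring.
Qed.

Lemma dpsii_ac_derive k : ac_derive (dpsii k) (fun x => potim k (q x) (psir k x) (psii k x)).
Proof.
apply: ac_derive_eq (ac_deriveD (ac_deriveM (ecos_ac_derive k) (dim_ac_derive k))
  (ac_deriveM (esin_ac_derive k) (dre_ac_derive k))) _ _ => //.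
apply: aeW => x _; rewrite /potim /psir /psii /dre /dim /decos /desin -/(u k) -/(v k).
by move: (ecos k x) (esin k x) (mre k x) (mim k x) (gre k x) (gim k x) (q x) => *; ring.
Qed.

Lemma psi_end k x : M <= x -> psir k x = ecos k x /\ psii k x = esin k x.
Proof.
move=> Mx; have [_ _ _ _ /(_ x Mx)] := jost_sys_psum M0 iq q0 (kap k).
rewrite -/(mre k) -/(mim k) => -[A1 B0 _ _].
by rewrite /psir /psii A1 B0 !mulr0 !mulr1 subr0 add0r.
Qed.

Lemma potE k (Q a b : R) :
  - (potre k Q a b +i* potim k Q a b) + Q%:C * (a +i* b) = k ^+ 2 * (a +i* b).
Proof.
case: k => c d; rewrite /potre /potim /u /v expr2 /=.
by apply/eqP; rewrite eq_complex; apply/andP; split; apply/eqP; simpl; ring.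
Qed.

Lemma pot_inv k (Q a b : R) (z : R[i]) : - z + Q%:C * (a +i* b) = k ^+ 2 * (a +i* b) ->
  complex.Re z = potre k Q a b /\ complex.Im z = potim k Q a b.
Proof.
rewrite -(potE k Q) => /addIr/oppr_inj ->; by [].
Qed.

Lemma jost_exists k : is_jost_solution q' k (fun x => psir k x +i* psii k x).
Proof.
split; last first.
  by exists M => x Mx; have [-> ->] := psi_end k Mx; rewrite cexp_ikx.
exists (fun x => dpsir k x +i* dpsii k x); split.
- by apply/loc_abs_continuousP => b b0; split; [exact: (psir_ac_derive k).1|exact:
  (psii_ac_derive k).1].
- by apply/loc_abs_continuousP => b b0; split; [exact: (dpsir_ac_derive k).1|exact:
  (dpsii_ac_derive k).1].
- by move=> x x0; split; [exact: psir_derive|exact: psii_derive].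
apply: filterS3 qq' (dpsir_ac_derive k).2 (dpsii_ac_derive k).2 => x qx d1 d2 x0.
exists (potre k (q x) (psir k x) (psii k x) +i* potim k (q x) (psir k x) (psii k x)).
  by split; [exact: d1|exact: d2].
by rewrite qx// potE.
Qed.

(** Gronwall's inequality is run backwards from y, where the energy vanishes. The conclusion at 0
    suffices, the Jost function being a value at 0. *)
Lemma solution_unique k (a b c d : R -> R) y :
  ac_derive a c -> ac_derive b d -> ac_derive c (fun x => potre k (q x) (a x) (b x)) ->
  ac_derive d (fun x => potim k (q x) (a x) (b x)) -> 0 < y ->
  a y = 0 -> b y = 0 -> c y = 0 -> d y = 0 -> a 0 = 0 /\ b 0 = 0.
Proof.
move=> da db dc dd y0 ay by0 cy dy.
have dE := ac_deriveD (ac_deriveD (ac_deriveM da da) (ac_deriveM db db)) (ac_deriveD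
  (ac_deriveM dc dc) (ac_deriveM dd dd)).
pose K : R := 1 + `|u k ^+ 2 - v k ^+ 2| + `|2 * u k * v k|.
have dH : ac_derive (fun x => prim M (fun t => `|q t|) x + K * x) (fun x => `|q x| + K * 1).
  apply: ac_deriveD; last exact: ac_deriveZ (@ac_derive_id R).
  by apply: prim_ac_derive; [exact: integ_norm|move=> z Mz; rewrite q0// normr0].
have := gronwall dE dH (lexx 0) (ltW y0).
rewrite ay by0 cy dy !mulr0 !addr0 mul0r mulr1 => h.
have {}h : (a 0 * a 0 + b 0 * b 0 + (c 0 * c 0 + d 0 * d 0)) *
    expR (prim M (fun t => `|q t|) 0) <= 0.
  apply: h => z z0 zy; rewrite /potre /potim /K.
  move: (a z) (b z) (c z) (d z) (q z) (u k ^+ 2 - v k ^+ 2) (2 * u k * v k) =>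
    a' b' c' d' Q p r.
  exact: energy_ge0.
have : a 0 * a 0 + b 0 * b 0 + (c 0 * c 0 + d 0 * d 0) <= 0.
  by rewrite -(pmulr_lle0 _ (expR_gt0 (prim M (fun t => `|q t|) 0))).
have := sqr_ge0 (a 0); have := sqr_ge0 (b 0); have := sqr_ge0 (c 0); have := sqr_ge0 (d 0).
rewrite !expr2 => h1 h2 h3 h4 h5.
split; apply/eqP; rewrite -[_ == 0]orbb -mulf_eq0; apply/eqP; lra.
Qed.

Lemma jost_unique k psi : is_jost_solution q' k psi ->
  psi 0 = psir k 0 +i* psii k 0.
Proof.
move=> [[psi1 [/loc_abs_continuousP c0 /loc_abs_continuousP c1 d0 d1]] [N NP]].
(* Strictly beyond both thresholds, so that the two solutions agree on a neighbourhood of y and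
   hence their first derivatives agree at y as well. *)
pose y := Num.max M N + 1.
have My : Num.max M N < y by rewrite /y; lra.
have y0 : 0 < y by apply: lt_le_trans M0 _; apply: ltW; apply: le_lt_trans My;
  rewrite le_max lexx.
pose re (f : R -> R[i]) x := complex.Re (f x); pose im (f : R -> R[i]) x := complex.Im (f x).
have ar : ac_derive (re psi) (re psi1).
  by split=> [b /c0[]//|]; apply: aeW => x /d0[].
have ai : ac_derive (im psi) (im psi1).
  by split=> [b /c0[]//|]; apply: aeW => x /d0[].
have P : {ae mu, forall x, 0 < x -> is_derive x 1 (re psi1) (potre k (q x) (re psi x)
  (im psi x)) /\
    is_derive x 1 (im psi1) (potim k (q x) (re psi x) (im psi x))}.
  apply: filterS2 qq' d1 => x qx dx x0; have [psi2 [p1 p2]] := dx x0.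
  rewrite qx// [psi x](_ : _ = re psi x +i* im psi x); last by rewrite /re /im; case: (psi x).
  by move/pot_inv => [<- <-].
have ar1 : ac_derive (re psi1) (fun x => potre k (q x) (re psi x) (im psi x)).
  by split=> [b /c1[]//|]; apply: filterS P => x h x0; have [] := h x0.
have ai1 : ac_derive (im psi1) (fun x => potim k (q x) (re psi x) (im psi x)).
  by split=> [b /c1[]//|]; apply: filterS P => x h x0; have [] := h x0.
have eqy z : Num.max M N <= z -> psir k z = re psi z /\ psii k z = im psi z.
  rewrite ge_max => /andP[Mz /NP e]; have [-> ->] := psi_end k Mz.
  by rewrite /re /im e cexp_ikx.
have [ey1 ey2] := eqy y (ltW My).
have near_y : \forall z \near y, Num.max M N <= z.
  by near=> z; apply/ltW; near: z; exact: lt_nbhsr.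
have dy1 : dpsir k y = re psi1 y.
  have h1 := psir_derive k y0; have [h2 _] := d0 y y0.
  rewrite -[LHS](@derive_val _ _ _ _ _ _ _ h1) -[RHS](@derive_val _ _ _ _ _ _ _ h2).
  by apply: near_eq_derive; near=> z; have [|-> _//] := eqy z; near: z.
have dy2 : dpsii k y = im psi1 y.
  have h1 := psii_derive k y0; have [_ h2] := d0 y y0.
  rewrite -[LHS](@derive_val _ _ _ _ _ _ _ h1) -[RHS](@derive_val _ _ _ _ _ _ _ h2).
  by apply: near_eq_derive; near=> z; have [|_ ->//] := eqy z; near: z.
have [||||||E1 E2] := @solution_unique k (fun x => psir k x - re psi x) (fun x =>
  psii k x - im psi x)
  (fun x => dpsir k x - re psi1 x) (fun x => dpsii k x - im psi1 x) y
  (ac_deriveB (psir_ac_derive k) ar) (ac_deriveB (psii_ac_derive k) ai) _ _ y0.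
- apply: ac_derive_eq (ac_deriveB (dpsir_ac_derive k) ar1) _ _ => //.
  by apply: aeW => x _; rewrite /potre; ring.
- apply: ac_derive_eq (ac_deriveB (dpsii_ac_derive k) ai1) _ _ => //.
  by apply: aeW => x _; rewrite /potim; ring.
- by rewrite ey1 subrr.
- by rewrite ey2 subrr.
- by rewrite dy1 subrr.
- by rewrite dy2 subrr.
move: E1 E2 => /eqP; rewrite subr_eq0 => /eqP -> /eqP; rewrite subr_eq0 => /eqP ->.
by rewrite /re /im; case: (psi 0).
Unshelve. all: by end_near. Qed.

(** Uniqueness at 0 makes the choice of [xget] harmless, and e^(ikx) is 1 at x = 0. *)
Lemma jost_functionE k : jost_function q' k = mre k 0 +i* mim k 0.
Proof.
rewrite /jost_function; have h : exists psi, is_jost_solution q' k psi.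
  by eexists; exact: jost_exists.
rewrite (jost_unique (psi := jost_solution q' k) (xgetPex
  (fun=> 0) h)) /psir /psii /ecos /esin !mulr0.
by rewrite expR0 cos0 sin0 !mulr1 !mulr0 !mul0r !mul1r subr0 addr0.
Qed.

End jost_solution.

(** * Estimates of the Jost function *)

Lemma cauchy2 (R : realDomainType) (x y X Y : R) :
  (x * X + y * Y) ^+ 2 <= (x ^+ 2 + y ^+ 2) * (X ^+ 2 + Y ^+ 2).
Proof. by have := sqr_ge0 (x * Y - y * X); lra. Qed.

(** Here v is m + g / kappa - 1, p is g / kappa, i1 + i i2 is 1 / kappa, and X + i Y is m / kappa
    with m = 1 + v - p. By Cauchy-Schwarz, |v + p|^2 <= 2 E and |m|^2 <= 3 E, the square of the left
    side is at most 6 (s E)^2, rounded up to 9 (s E)^2. *)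
Lemma energy_bound (R : realFieldType) (v1 v2 p1 p2 i1 i2 s X Y : R) : 0 <= s ->
  i1 ^+ 2 + i2 ^+ 2 <= s ^+ 2 ->
  X = i1 * (1 + v1 - p1) - i2 * (v2 - p2) ->
  Y = i2 * (1 + v1 - p1) + i1 * (v2 - p2) ->
  `|(v1 + p1) * X + (v2 + p2) * Y| <=
    3 * s * (1 + (v1 ^+ 2 + v2 ^+ 2 + (p1 ^+ 2 + p2 ^+ 2))).
Proof.
move=> s0 is2 XE YE.
pose E := 1 + (v1 ^+ 2 + v2 ^+ 2 + (p1 ^+ 2 + p2 ^+ 2)).
have := sqr_ge0 v1; have := sqr_ge0 v2; have := sqr_ge0 p1; have := sqr_ge0 p2.
move=> h1 h2 h3 h4.
have E0 : 0 <= E by rewrite /E; lra.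
rewrite -/E -ler_sqr ?nnegrE ?mulr_ge0// real_normK ?num_real//.
apply: le_trans (cauchy2 _ _ _ _) _.
have e1 : (v1 + p1) ^+ 2 + (v2 + p2) ^+ 2 <= 2 * E.
  by have := sqr_ge0 (v1 - p1); have := sqr_ge0 (v2 - p2); rewrite /E; lra.
have XY : X ^+ 2 + Y ^+ 2 = (i1 ^+ 2 + i2 ^+ 2) * ((1 + v1 - p1) ^+ 2 + (v2 - p2) ^+ 2).
  by rewrite XE YE; ring.
have e2 : (1 + v1 - p1) ^+ 2 + (v2 - p2) ^+ 2 <= 3 * E.
  have := sqr_ge0 (v2 + p2); have := sqr_ge0 (1 - v1); have := sqr_ge0 (1 + p1).
  by have := sqr_ge0 (v1 + p1); rewrite /E; lra.
have e3 : X ^+ 2 + Y ^+ 2 <= s ^+ 2 * (3 * E).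
  by rewrite XY; apply: ler_pM => //; rewrite addr_ge0 ?sqr_ge0.
apply: (@le_trans _ _ ((2 * E) * (s ^+ 2 * (3 * E)))).
  by apply: ler_pM => //; rewrite addr_ge0 ?sqr_ge0.
rewrite [leLHS](_ : _ = 6 * (s * E) ^+ 2); last by ring.
rewrite [leRHS](_ : _ = 9 * (s * E) ^+ 2); last by ring.
by have := sqr_ge0 (s * E); lra.
Qed.

(** Gronwall's hypothesis for 1 + |v|^2 + |p|^2 in the notation of [energy_bound], with kappa = al +
    i be and w the value of q. The rate 6 s |w| is twice the bound found there; 2 t absorbs the term
    - 2 Re kappa |p|^2, so that Re kappa has to be bounded from above only. *)
Lemma jost_energy_ge0 (R : realFieldType) (al be i1 i2 s t a b c d w : R) :
  i1 * al - i2 * be = 1 -> i1 * be + i2 * al = 0 -> 0 <= s ->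
  i1 ^+ 2 + i2 ^+ 2 <= s ^+ 2 -> 0 <= t -> al <= t ->
  let dp1 := i1 * (w * a - (al * c - be * d)) - i2 * (w * b - (al * d + be * c)) in
  let dp2 := i2 * (w * a - (al * c - be * d)) + i1 * (w * b - (al * d + be * c)) in
  let p1 := i1 * c - i2 * d in let p2 := i2 * c + i1 * d in
  0 + ((c + dp1 - 0) * (a + p1 - 1) + (a + p1 - 1) * (c + dp1 - 0) +
       ((d + dp2) * (b + p2) + (b + p2) * (d + dp2)) +
       (dp1 * p1 + p1 * dp1 + (dp2 * p2 + p2 * dp2))) +
  (6 * s * `|w| + 2 * t * 1) *
    (1 + ((a + p1 - 1) * (a + p1 - 1) + (b + p2) * (b + p2) + (p1 * p1 + p2 * p2))) >= 0.
Proof.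
move=> iE1 iE2 s0 i12 t0 at_ /=.
set dp1 := i1 * (_ - _) - _; set dp2 := i2 * (_ - _) + _.
set p1 := i1 * c - i2 * d; set p2 := i2 * c + i1 * d.
have cE : c = al * p1 - be * p2.
  rewrite /p1 /p2 [RHS](_ : _ = c * (i1 * al - i2 * be) - d * (i1 * be + i2 * al));
    last by ring.
  by rewrite iE1 iE2; ring.
have dE : d = al * p2 + be * p1.
  rewrite /p1 /p2 [RHS](_ : _ = d * (i1 * al - i2 * be) + c * (i1 * be + i2 * al));
    last by ring.
  by rewrite iE1 iE2; ring.
pose X := i1 * a - i2 * b; pose Y := i2 * a + i1 * b.
have dp1E : dp1 = w * X - c.
  rewrite /dp1 [LHS](_ : _ = w * X - c * (i1 * al - i2 * be) + d * (i1 * be + i2 * al));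
    last by rewrite /X; ring.
  by rewrite iE1 iE2; ring.
have dp2E : dp2 = w * Y - d.
  rewrite /dp2 [LHS](_ : _ = w * Y - d * (i1 * al - i2 * be) - c * (i1 * be + i2 * al));
    last by rewrite /Y; ring.
  by rewrite iE1 iE2; ring.
have XE : X = i1 * (1 + (a + p1 - 1) - p1) - i2 * ((b + p2) - p2) by rewrite /X; ring.
have YE : Y = i2 * (1 + (a + p1 - 1) - p1) + i1 * ((b + p2) - p2) by rewrite /Y; ring.
have := energy_bound s0 i12 XE YE.
rewrite dp1E dp2E; clear dp1E dp2E XE YE dp1 dp2.
move: (a + p1 - 1) (b + p2) => v1 v2.
move: cE dE; move: X Y p1 p2 => X Y p1 p2 -> ->.
pose E := 1 + (v1 ^+ 2 + v2 ^+ 2 + (p1 ^+ 2 + p2 ^+ 2)).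
pose T := (v1 + p1) * X + (v2 + p2) * Y; rewrite -/E -/T => TE.
rewrite [leRHS](_ : _ = 2 * (w * T + `|w| * (3 * s * E)) +
   2 * (t * (1 + v1 ^+ 2 + v2 ^+ 2) + (t - al) * (p1 ^+ 2 + p2 ^+ 2))); last first.
  by rewrite /T /E; ring.
have wT : 0 <= `|w| * (3 * s * E) + w * T.
  by apply: norm_mul_ge0; move: TE; rewrite ler_norml => /andP[].
have h1 : 0 <= t * (1 + v1 ^+ 2 + v2 ^+ 2).
  by rewrite mulr_ge0// !addr_ge0 ?sqr_ge0.
have h2 : 0 <= (t - al) * (p1 ^+ 2 + p2 ^+ 2).
  by rewrite mulr_ge0 ?subr_ge0// addr_ge0 ?sqr_ge0.
by move: wT h1 h2; move: (`|w| * _) (w * T) (t * _) ((t - al) * _) => *; lra.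
Qed.

Section estimates.
Variables (R : realType) (M : R) (q : R -> R).
Hypothesis M0 : 0 < M.
Hypothesis iq : integ M q.
Hypothesis q0 : forall x, M < x -> q x = 0.
Notation mu := (@lebesgue_measure R).
Implicit Types (x y : R) (k : R[i]).

Let Q : R := - prim M (fun t => `|q t|) 0.

Lemma norm_q_ge0 : 0 <= Q.
Proof.
have := weight_ge0 iq q0 (lexx 0) (lexx 0) (ltW M0).
by rewrite /weight mul0r sub0r.
Qed.

(* With g = m', the combinations v = m + g / k and p = g / k satisfy
   v' = q m / k and p' = q m / k - k p, so that 1 + |v - 1|^2 + |p|^2 obeys
   Gronwall's inequality with a rate that is small when k is large. *)
Lemma jost_sys_bound k (A B C D : R -> R) (s t : R) : jost_sys M q k A B C D ->
  k != 0 -> 0 <= s -> 1 <= s ^+ 2 * (complex.Re k ^+ 2 + complex.Im k ^+ 2) ->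
  0 <= t -> complex.Re k <= t ->
  (A 0 - 1) ^+ 2 + B 0 ^+ 2 <= 2 * (expR (6 * s * Q + 2 * t * M) - 1).
Proof.
case: k => al be [dA dB dC dD end_] k0 s0 /= sk t0 at_.
have n0 : 0 < al ^+ 2 + be ^+ 2.
  rewrite lt_neqAle addr_ge0 ?sqr_ge0// andbT eq_sym paddr_eq0 ?sqr_ge0//.
  by rewrite !sqrf_eq0; apply: contraNN k0; rewrite eq_complex.
pose i1 := al / (al ^+ 2 + be ^+ 2); pose i2 := - be / (al ^+ 2 + be ^+ 2).
have i12 : i1 ^+ 2 + i2 ^+ 2 <= s ^+ 2.
  rewrite (_ : _ + _ = (al ^+ 2 + be ^+ 2)^-1).
    by rewrite -(ler_pM2r n0) mulVf// gt_eqF.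
  by rewrite /i1 /i2; field; rewrite gt_eqF.
have iE1 : i1 * al - i2 * be = 1 by rewrite /i1 /i2; field; rewrite gt_eqF.
have iE2 : i1 * be + i2 * al = 0 by rewrite /i1 /i2; field; rewrite gt_eqF.
have dp1 := ac_deriveB (ac_deriveZ i1 dC) (ac_deriveZ i2 dD).
have dp2 := ac_deriveD (ac_deriveZ i2 dC) (ac_deriveZ i1 dD).
have dv1 := ac_deriveB (ac_deriveD dA dp1) (ac_derive_cst 1).
have dv2 := ac_deriveD dB dp2.
have dE := ac_deriveD (ac_derive_cst 1) (ac_deriveD (ac_deriveD (ac_deriveM dv1 dv1)
  (ac_deriveM dv2 dv2))
   (ac_deriveD (ac_deriveM dp1 dp1) (ac_deriveM dp2 dp2))).
have dn : ac_derive (prim M (fun z => `|q z|)) (fun z => `|q z|).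
  by apply: prim_ac_derive; [exact: integ_norm|move=> z Mz; rewrite q0// normr0].
have dH := ac_deriveD (ac_deriveZ (6 * s) dn) (ac_deriveZ (2 * t) (@ac_derive_id R)).
have := gronwall dE dH (lexx 0) (ltW M0).
have [A1 B0 C0 D0] := end_ M (lexx M).
rewrite A1 B0 C0 D0 (prim0 (integ_norm iq) (lexx M)).
rewrite !mulr0 !subr0 !addr0 subrr !mulr0 !addr0 mul1r add0r => h.
have {}h : (1 + ((A 0 + (i1 * C 0 - i2 * D 0) - 1) * (A 0 + (i1 * C 0 - i2 * D 0) - 1) +
    (B 0 + (i2 * C 0 + i1 * D 0)) * (B 0 + (i2 * C 0 + i1 * D 0)) +
    ((i1 * C 0 - i2 * D 0) * (i1 * C 0 - i2 * D 0) +
     (i2 * C 0 + i1 * D 0) * (i2 * C 0 + i1 * D 0)))) *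
    expR (6 * s * prim M (fun z => `|q z|) 0) <= expR (2 * t * M).
  apply: h => z z0 zM /=.
  move: (A z) (B z) (C z) (D z) (q z) => {dA dB dC dD end_ dp1 dp2 dv1 dv2 dE A1 B0 C0 D0}.
  by move=> a b c d w; exact: jost_energy_ge0.
move: h; rewrite (_ : 6 * s * _ = - (6 * s * Q)); last by rewrite /Q mulrN opprK.
rewrite expRN ler_pdivrMr ?expR_gt0// -expRD [2 * t * M + _]addrC.
move: (expR _) => X.
(* With v = m + g / kappa - 1 and p = g / kappa, this is the square of the real part of v + p, while
   m - 1 = v - p. The parallelogram identity gives |m - 1|^2 <= 2 (|v|^2 + |p|^2). *)
have := sqr_ge0 (A 0 - 1 + 2 * (i1 * C 0 - i2 * D 0)).
have := sqr_ge0 (B 0 + 2 * (i2 * C 0 + i1 * D 0)).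
move: (i1 * C 0 - i2 * D 0) (i2 * C 0 + i1 * D 0) (A 0) (B 0) => p1 p2 a b.
lra.
Qed.

Lemma growthE k : growth M q k = size1 k * M + Q.
Proof. by rewrite /growth /weight subr0. Qed.

Lemma psum_le_growth k : `|psum (itma M q) k 0| <= expR (size1 k * M + Q) /\
  `|psum (itmb M q) k 0| <= expR (size1 k * M + Q).
Proof.
have h1 := psum_ma M0 iq q0 k (lexx 0) 0; have h2 := psum_mb M0 iq q0 k (lexx 0) 0.
move: h1 h2; rewrite /exp_tail !seriesEnat/= !big_geq// !subr0 growthE.
by split.
Qed.

Definition partial_poly N : {poly R[i]} :=
  \sum_(n < N) \sum_(j < n.+1) ((iter_mg M q n).1 j 0)%:C *: 'X^j.

Lemma complex_sum (I : Type) (r : seq I) (F : I -> R[i]) :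
  \sum_(i <- r) F i = (\sum_(i <- r) complex.Re (F i)) +i* (\sum_(i <- r) complex.Im (F i)).
Proof.
elim: r => [|i r IH]; first by rewrite !big_nil.
by rewrite !big_cons IH; case: (F i).
Qed.

Lemma partial_polyE N k : (partial_poly N).[k] =
  series (fun n => itma M q k n 0) N +i* series (fun n => itmb M q k n 0) N.
Proof.
rewrite /partial_poly horner_sum complex_sum !seriesEord/=.
by congr (_ +i* _); apply: eq_bigr => n _; rewrite horner_sum complex_sum /=;
  apply: eq_bigr => j _; rewrite hornerZ hornerXn /pow_re /pow_im; case: (k ^+ j) => a b /=;
    ring.
Qed.

(** The exponential majorant depends on k only through [growth], which increases with [size1 k]; one
    N thus serves the whole region. *)
Lemma jost_sum_approx (r e : R) : 0 < e -> exists N, forall k, size1 k <= r ->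
  cmod ((psum (itma M q) k 0 +i* psum (itmb M q) k 0) - (partial_poly N).[k]) <= e.
Proof.
move=> e0; pose g := r * M + Q; have e2 : 0 < e / 2 by lra.
have : series (exp_coeff g) @ \oo --> expR g by exact: is_cvg_series_exp_coeff.
move=> /cvgrPdist_le/(_ _ e2)[N _ /(_ N (leqnn N)) /= NP].
exists N => k kr; rewrite partial_polyE.
have le n : exp_coeff (growth M q k) n <= exp_coeff g n.
  rewrite /exp_coeff /= ler_wpM2r ?invr_ge0// lerXn2r ?nnegrE//.
  - exact: (weight_ge0 iq q0 (size1_ge0 k) (lexx 0) (ltW M0)).
  - by rewrite addr_ge0 ?norm_q_ge0// mulr_ge0 ?(ltW M0)// (le_trans (size1_ge0 k)).
  - by rewrite growthE lerD2r ler_wpM2r// ltW.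
have ha n : `|itma M q k n 0| <= exp_coeff g n.
  by apply: le_trans (le n); have [] := picard_le_exp M0 iq q0 k n (lexx 0).
have hb n : `|itmb M q k n 0| <= exp_coeff g n.
  by apply: le_trans (le n); have [] := picard_le_exp M0 iq q0 k n (lexx 0).
have [_ /(_ N) ta] := series_tail ha (is_cvg_series_exp_coeff g).
have [_ /(_ N) tb] := series_tail hb (is_cvg_series_exp_coeff g).
apply: le_trans (cmod_le_ReIm _) _.
have := le_trans (ler_norm _) NP => NP'.
have h1 := le_trans ta NP'; have h2 := le_trans tb NP'.
by rewrite (splitr e); exact: lerD h1 h2.
Qed.

End estimates.

(** * Counting the zeros of the Jost function *)

Section zeros.
Variables (R : realType) (M : R) (q q' : R -> R).
Hypothesis M0 : 0 < M.
Hypothesis iq : integ M q.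
Hypothesis q0 : forall x, M < x -> q x = 0.
Notation mu := (@lebesgue_measure R).
Hypothesis qq' : {ae mu, forall x, 0 < x -> q' x = q x}.
Implicit Types (x y : R) (k : R[i]).

Let Q : R := - prim M (fun t => `|q t|) 0.
Let Q0 : 0 <= Q. Proof. exact: norm_q_ge0. Qed.

Lemma normrC (z : R[i]) : `|z| = (cmod z)%:C.
Proof. by []. Qed.

Lemma jostE k : jost_function q' k = psum (itma M q) (kap k) 0 +i* psum (itmb M q) (kap k) 0.
Proof. exact: jost_functionE. Qed.

Lemma kapE k : kap k = (0 +i* 2) * k.
Proof.
by case: k => a b; rewrite /kap; apply/eqP; rewrite eq_complex; apply/andP; split; apply/eqP;
  simpl; ring.
Qed.

Lemma size1_kap k : size1 (kap k) <= 1 + 4 * cmod k.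
Proof.
rewrite /size1 /kap /= !normrM normrN !normr_nat.
by have := cmod_ge_Re k; have := cmod_ge_Im k; lra.
Qed.

(** The number 2 i k has nonpositive real part and modulus at least 2 T, so the exponent in
    [jost_sys_bound] is 6 Q / (2 T) <= 1 / 9. As exp (1 / 9) <= 9 / 8, this gives |w - 1|^2 <= 1 /
    4; hence the constant 27. *)
Lemma jost_far k T : 0 < T -> T <= complex.Im k -> 27 * Q <= T ->
  1 / 2 <= cmod (jost_function q' k).
Proof.
move=> T0 Tk QT.
have k0 : kap k != 0.
  rewrite eq_complex /= negb_and mulNr oppr_eq0 mulf_neq0//.
  by rewrite gt_eqF// (lt_le_trans T0).
have s0 : 0 <= (2 * T)^-1 by rewrite invr_ge0 mulr_ge0// ltW.
have sk : 1 <= (2 * T)^-1 ^+ 2 * (complex.Re (kap k) ^+ 2 + complex.Im (kap k) ^+ 2).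
  rewrite /kap /= exprVn -ler_pdivrMl ?invr_gt0 ?exprn_gt0 ?mulr_gt0// invrK mulr1.
  have : T ^+ 2 <= complex.Im k ^+ 2 by rewrite lerXn2r ?nnegrE// ltW// (lt_le_trans T0).
  by have := sqr_ge0 (complex.Re k); lra.
have Rek : complex.Re (kap k) <= 0.
  by rewrite /kap /= mulNr oppr_le0 mulr_ge0// ltW// (lt_le_trans T0).
have := jost_sys_bound M0 iq q0 (jost_sys_psum M0 iq q0 (kap k)) k0 s0 sk (lexx 0) Rek.
rewrite mulr0 mul0r addr0 -/Q.
have e9 : expR (6 * (2 * T)^-1 * Q) <= 9 / 8.
  apply: (@le_trans _ _ (expR (1 / 9))).
    rewrite ler_expR (_ : _ * Q = (3 * Q) / T); last by field; rewrite gt_eqF.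
    by rewrite ler_pdivrMr//; lra.
  have X0 := expR_ge0 (1 / 9 : R); have Y0 := expR_ge1Dx (- (1 / 9) : R).
  have XY : expR (1 / 9) * expR (- (1 / 9)) = 1 :> R by rewrite -expRD subrr expR0.
  by have := ler_wpM2l X0 Y0; rewrite XY; lra.
move=> h; rewrite jostE.
have {}h : (psum (itma M q) (kap k) 0 - 1) ^+ 2 <= (1 / 2) ^+ 2.
  by have := sqr_ge0 (psum (itmb M q) (kap k) 0); lra.
apply: le_trans (cmod_ge_Re _); rewrite /=; apply: le_trans (ler_norm _).
have : `|psum (itma M q) (kap k) 0 - 1| <= 1 / 2.
  by rewrite -ler_sqr ?nnegrE// real_normK ?num_real.
by rewrite ler_norml => /andP[]; lra.
Qed.

Definition jost_cst : R := 5 * expR (3 * Q + 3 * M).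

(** If |kappa| >= 1, the system bound with s = 1 and t = 2 Y gives |w - 1|^2 <= 2 X^2 for X = exp (3
    Q + 2 M Y), so that |Re w| + |Im w| <= 4 X + 1 <= 5 X: this is the 5 of [jost_cst]. If |kappa| <
    1, division by kappa costs too much and the series bound with [size1] at most 3 takes over,
    whence the 3 M. *)
Lemma jost_upper k Y : 0 <= Y -> - Y <= complex.Im k ->
  cmod (jost_function q' k) <= jost_cst * expR (2 * M * Y).
Proof.
move=> Y0 Yk; rewrite jostE; apply: le_trans (cmod_le_ReIm _) _ => /=.
have MY : 0 <= 2 * M * Y by rewrite !mulr_ge0// ltW.
rewrite /jost_cst -mulrA -expRD.
have [k1|k1] := leP 1 (complex.Re (kap k) ^+ 2 + complex.Im (kap k) ^+ 2).
  have k0 : kap k != 0.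
    by apply: contraTneq k1 => ->; rewrite /= expr0n /= addr0 ler10.
  have Rek : complex.Re (kap k) <= 2 * Y by rewrite /kap /=; lra.
  have := jost_sys_bound M0 iq q0 (jost_sys_psum M0 iq q0 (kap k)) k0 ler01 _ _ Rek.
  rewrite expr1n mul1r -/Q => /(_ k1); rewrite mulr_ge0// => /(_ isT).
  pose X := expR (3 * Q + 2 * M * Y).
  have X1 : 1 <= X by rewrite -expR0 ler_expR addr_ge0// mulr_ge0.
  have -> : expR (6 * 1 * Q + 2 * (2 * Y) * M) = X ^+ 2.
    by rewrite expr2 -expRD; congr expR; ring.
  have XX : X <= expR (3 * Q + 3 * M + 2 * M * Y).
    by rewrite ler_expR; have := ltW M0; lra.
  move: (psum (itma M q) _ _) (psum (itmb M q) _ _) => a b h.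
  have ha : `|a - 1| <= 2 * X.
    rewrite -ler_sqr ?nnegrE// ?mulr_ge0// ?(le_trans _ X1)// real_normK ?num_real//.
    by have := sqr_ge0 b; have := sqr_ge0 X; lra.
  have hb : `|b| <= 2 * X.
    rewrite -ler_sqr ?nnegrE// ?mulr_ge0// ?(le_trans _ X1)// real_normK ?num_real//.
    by have := sqr_ge0 (a - 1); have := sqr_ge0 X; lra.
  have := ler_normD (a - 1) 1; rewrite subrK normr1; lra.
have s3 : size1 (kap k) <= 3.
  have hR : `|complex.Re (kap k)| <= 1.
    rewrite -ler_sqr ?nnegrE// real_normK ?num_real// expr1n.
    by have := sqr_ge0 (complex.Im (kap k)); lra.
  have hI : `|complex.Im (kap k)| <= 1.
    rewrite -ler_sqr ?nnegrE// real_normK ?num_real// expr1n.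
    by have := sqr_ge0 (complex.Re (kap k)); lra.
  by rewrite /size1; lra.
have [] := psum_le_growth M0 iq q0 (kap k); rewrite -/Q.
have : expR (size1 (kap k) * M + Q) <= expR (3 * Q + 3 * M + 2 * M * Y).
  by rewrite ler_expR; have : size1 (kap k) * M <= 3 * M;
    [rewrite ler_wpM2r// ltW|have := Q0; lra].
have := expR_gt0 (3 * Q + 3 * M + 2 * M * Y); lra.
Qed.

(** The radius 3 (2 T + 1) puts the zeros in the inner third of the disc, as [jensen] requires, and
    T - 3 (2 T + 1) = - (5 T + 3) is the lowest imaginary part in the disc. The left side is the
    lower bound of [jost_far] at the centre. *)
Lemma zeros_bound T (c : R[i]) (s : seq R[i]) : 0 < T -> 27 * Q <= T -> complex.Im c = T ->
  uniq s -> (forall z, z \in s -> cmod (z - c) <= 2 * T + 1 /\ jost_function q' z = 0) ->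
  1 / 2 <= jost_cst * expR (2 * M * (5 * T + 3)) / 2 ^+ size s.
Proof.
move=> T0 QT cT us zs.
pose r := 3 * (2 * T + 1); have r0 : 0 < r by rewrite /r; lra.
pose B := jost_cst * expR (2 * M * (5 * T + 3)).
have B0 : 0 <= B by rewrite !mulr_ge0 ?expR_ge0.
have Imu (u : R[i]) : `|u| <= r%:C -> - (5 * T + 3) <= complex.Im (c + u).
  rewrite normrC lecR => ur; have := le_trans (cmod_ge_Im u) ur;
    rewrite ler_norml => /andP[h _].
  have -> : complex.Im (c + u) = T + complex.Im u by rewrite -cT; case: (c) (u) => ? ? [].
  by move: h; rewrite /r; lra.
have := @jensen R[i] [seq z - c | z <- s] (fun u => jost_function q' (c + u)) r%:C B%:C.
rewrite size_map addr0 ltcR => /(_ r0); rewrite ler0c => /(_ B0).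
rewrite map_inj_uniq => [/(_ us)|x y /addIr//].
move=> h; have {}h : `|jost_function q' c| <= B%:C / 2 ^+ size s.
  apply: h => [z /mapP[y ys ->]|e e0|u ur].
  - have [h1 h2] := zs y ys; rewrite [c + _]addrC subrK; split=> //.
    rewrite normrC (_ : r%:C / 3 = (2 * T + 1)%:C) ?lecR//.
    by rewrite /r rmorphM/= rmorph_nat mulrC mulKf// pnatr_eq0.
  - case: e e0 => e e'; rewrite ltcE /= => /andP[/eqP -> e0].
    have [N NP] := jost_sum_approx M0 iq q0 (1 + 4 * (cmod c + r)) e0.
    (* [partial_poly] is a polynomial in kappa; the composition substitutes kappa = 2 i (c + u). *)
    exists (partial_poly M q N \Po ((0 +i* 2) *: 'X + ((0 +i* 2) * c)%:P)) => u.
    rewrite !normrC !lecR => ur; rewrite horner_comp hornerD hornerZ hornerX hornerC.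
    rewrite -mulrDr [u + c]addrC -kapE jostE; apply: NP.
    apply: le_trans (size1_kap _) _; rewrite lerD2l ler_wpM2l//.
    by apply: le_trans (le_normcD _ _) _; rewrite lerD2l.
  - by rewrite normrC lecR; apply: jost_upper; [lra|exact: Imu].
have n2 : 2 ^+ size s = (2 ^+ size s)%:C :> R[i] by rewrite rmorphXn /= rmorph_nat.
move: h; rewrite normrC n2 -fmorph_div lecR; apply: le_trans.
by apply: (jost_far T0) => //; rewrite cT.
Qed.

End zeros.

(** The Jost solution sees q only up to null sets, so q may be replaced by a representative that
    vanishes everywhere beyond M. *)
Lemma potential_cut (R : realType) (q' : R -> R) : potential q' ->
  exists M q, [/\ 0 < M, integ M q, forall x, M < x -> q x = 0 &
    {ae lebesgue_measure, forall x : R, 0 < x -> q' x = q x}].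
Proof.
move=> [iq [N qN]]; pose M := Num.max N 1.
have M0 : 0 < M by rewrite lt_max ltr01 orbT.
pose q x := if x <= M then q' x else 0.
exists M, q; split=> //.
- have : lebesgue_measure.-integrable (`[0, M]%classic : set R) (EFin \o q').
    apply: integrableS iq => //.
    by move=> x /=; rewrite !in_itv/= => /andP[->].
  apply: eq_integrable => // x; rewrite inE/= in_itv/= => /andP[_ xM].
  by rewrite /q xM.
- by move=> x; rewrite /q ltNge => /negbTE ->.
- apply: filterS qN => x h x0; rewrite /q; case: ifPn => //; rewrite -ltNge => Mx.
  by apply: h; apply: le_lt_trans Mx; rewrite le_max lexx.
Qed.

(** * The clusters *)

Lemma counting_le_size (T : choiceType) (R : realType) (A : set T) (s : seq T) :
  A `<=` [set` s] -> (counting A <= (size s)%:R%:E :> \bar R)%E.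
Proof.
move=> As; have fA : finite_set A by apply: sub_finite_set As _; exact: finite_seq.
rewrite /counting asboolT// lee_fin ler_nat.
apply: leq_trans (size_undup s); rewrite -finmap.card_fseq.
apply/finmap.fsubset_leq_card/finmap.fsubsetP => x.
by rewrite in_fset_set// => /set_mem xA; rewrite finmap.in_fset; exact: As.
Qed.

(** Turns powers of 2 into exponentials, so that exponents can be compared; exp (1 / 2) <= 2 follows
    from exp (- 1 / 2) >= 1 / 2. *)
Lemma expR_half_le (R : realType) (n : nat) : expR (n%:R / 2) <= 2 ^+ n :> R.
Proof.
have h : expR (1 / 2) <= 2 :> R.
  have X0 := expR_ge0 (1 / 2 : R); have Y0 := expR_ge1Dx (- (1 / 2) : R).
  have XY : expR (1 / 2) * expR (- (1 / 2)) = 1 :> R by rewrite -expRD subrr expR0.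
  by have := ler_wpM2l X0 Y0; rewrite XY; lra.
rewrite (_ : n%:R / 2 = (1 / 2) * n%:R); last by ring.
by rewrite expRM_natr lerXn2r ?nnegrE ?expR_ge0.
Qed.

Lemma ten_le_expR9 (R : realType) : 10 <= expR 9 :> R.
Proof. by have := expR_ge1Dx (9 : R); lra. Qed.

(** The last three bounds give n T < 38 + 12 Q + 36 M + 40 M T, whereas n T >= 44 T + 39 Q T + 76 M
    T; these are incompatible for T >= 1. The summand 27 Q also secures the condition of
    [jost_far]. *)
Lemma cluster_arith (R : realFieldType) (Q M T n m rho : R) : 0 <= Q -> 0 <= M -> 1 <= T ->
  27 * Q + 4 * (11 + 3 * Q + 19 * M) <= n -> n * T <= rho -> rho / 2 < m + 1 ->
  m / 2 <= 9 + (3 * Q + 3 * M) + 2 * M * (5 * T + 3) -> False.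
Proof.
move=> Q0 M0 T1 nQ nT rm mQ.
have T0 : 0 <= T by lra.
have h1 := ler_wpM2r T0 nQ.
have h2 := ler_wpM2l Q0 T1; have h3 := ler_wpM2l M0 T1.
move: h1 h2 h3 mQ nT.
rewrite (_ : (_ + _) * T = 39 * (Q * T) + 44 * T + 76 * (M * T)); last by ring.
rewrite (_ : 2 * M * _ = 10 * (M * T) + 6 * M); last by ring.
move: (Q * T) (M * T) (n * T) => a b c; lra.
Qed.

Section construction.
Variables (R : realType) (tau rho : R -> R).
Hypothesis tau_pos : forall r : R, 0 <= r -> 0 < tau r.
Hypothesis rho_pos : forall r : R, 0 <= r -> 0 < rho r.
Hypothesis tau_unbounded : forall M : R, exists2 r : R, 0 <= r & M < tau r.
Hypothesis tau_incr : {in `[0, +oo[ &, {homo tau : r s / r <= s}}.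
Hypothesis rho_incr : {in `[0, +oo[ &, {homo rho : r s / r <= s}}.
Hypothesis tau_cont : {within `[0, +oo[, continuous tau}.
Hypothesis tau_o_rho : forall e : R, 0 < e ->
     \forall r \near +oo, `|tau r| <= e * `|rho r|.
Hypothesis tau_lt_id : forall M : R, exists2 r : R, M < r & tau r < r.

Lemma tau_mono r s : 0 <= r -> r <= s -> tau r <= tau s.
Proof.
by move=> r0 rs; apply: tau_incr => //; rewrite in_itv/= andbT// (le_trans r0).
Qed.

(** Here r is the modulus of the first point of the cluster, t the common depth and e the bound on
    the width. The moduli will stay between r and r + e, where tau <= t puts the cluster in the
    prescribed region. *)
Definition cluster_spec (n : nat) (p : R * R * R) :=
  let: (r, t, e) := p in
  [/\ n%:R < r /\ t < r, n%:R <= t, n%:R * t <= rho r, 0 < e <= 1 &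
    forall s, r <= s -> s <= r + e -> tau s <= t].

Lemma cluster_exists n : exists p, cluster_spec n p.
Proof.
(* The factor 2 absorbs the passage from tau r to the depth t = tau (r + e), which will be at most 2
   tau r. *)
have c0 : 0 < (2 * (n.+1)%:R)^-1 :> R by rewrite invr_gt0 mulr_gt0.
have [A [Areal AP]] := tau_o_rho c0.
have [r1 r10 r1P] := tau_unbounded (Num.max 1 n%:R).
have [r rM tr] := tau_lt_id (Num.max (Num.max A r1) n%:R).
move: rM; rewrite !gt_max => /andP[/andP[Ar r1r] nr].
have r0 : 0 < r by exact: le_lt_trans r10 r1r.
have [t1 tn] : 1 <= tau r /\ n%:R <= tau r.
  have : Num.max 1 n%:R < tau r by apply: lt_le_trans r1P _; apply: tau_mono => //; exact: ltW.
  by rewrite gt_max => /andP[/ltW ? /ltW].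
have rt : 2 * n.+1%:R * tau r <= rho r.
  have := AP r Ar; rewrite !ger0_norm ?(ltW (rho_pos (ltW r0))) ?(ltW (tau_pos (ltW r0)))//.
  by rewrite -ler_pdivrMl ?invr_gt0 ?mulr_gt0// invrK.
have cr : {for r, continuous tau}.
  have : {within `]0, +oo[, continuous tau}.
    apply: continuous_subspaceW tau_cont => x /=; rewrite !in_itv/= !andbT; exact: ltW.
  rewrite continuous_open_subspace; last exact: interval_open.
  by apply; apply: mem_set; rewrite /= in_itv/= r0.
(* Continuity will keep tau (r + e) below tau r + 1 <= 2 tau r and below r; the latter lets a point
   of modulus r have depth tau (r + e). *)
have e0 : 0 < Num.min 1 (r - tau r) by rewrite lt_min ltr01 subr_gt0.
have /cvgrPdist_lt/(_ _ e0)/nbhs_ballP[d /= d0 dP] := cr.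
pose e := Num.min (d / 2) 1.
have e00 : 0 < e by rewrite lt_min divr_gt0// ltr01.
have ed : e < d by rewrite /e gt_min; apply/orP; left; lra.
have := dP (r + e); rewrite /ball/= opprD addrA subrr sub0r normrN gtr0_norm// => /(_ ed).
rewrite distrC lt_min => /andP[]; rewrite !ltr_distl => /andP[_ h1] /andP[_ h2].
exists (r, tau (r + e), e) => /=.
have tt : tau r <= tau (r + e) by apply: tau_mono; [exact: ltW|rewrite lerDl ltW].
split.
- by split=> //; lra.
- exact: le_trans tt.
- apply: le_trans rt; apply: (@le_trans _ _ (n%:R * (2 * tau r))).
    by rewrite ler_wpM2l//; lra.
  rewrite [leRHS](_ : _ = n.+1%:R * (2 * tau r)); last by ring.
  by rewrite ler_wpM2r ?ler_nat// mulr_ge0//; lra.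
- by rewrite e00 /= /e ge_min lexx orbT.
- by move=> s rs se; apply: tau_mono => //; exact: le_trans (ltW r0) rs.
Qed.

Let sel n := projT1 (cid (cluster_exists n)).
Let selP n : cluster_spec n (sel n) := projT2 (cid (cluster_exists n)).
Let rr n := (sel n).1.1.
Let tt n := (sel n).1.2.
Let ee n := (sel n).2.
Let spec n : [/\ n%:R < rr n /\ tt n < rr n, n%:R <= tt n, n%:R * tt n <= rho
  (rr n), 0 < ee n <= 1 &
    forall s, rr n <= s -> s <= rr n + ee n -> tau s <= tt n].
Proof. by have := selP n; rewrite /rr /tt /ee; case: (sel n) => [[]]. Qed.

Let mult n : nat := Num.truncn (rho (rr n) / 2).

(** The number of points in the first j clusters. The index of the next one, named [idx j] below, is
    at least [2 * total j] to leave room for the earlier points, at least j to outgrow every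
    constant, and at least 2 to keep the depth above 1. *)
Fixpoint total j : nat := if j is j'.+1 then (total j' + mult
  (2 * total j' + j' + 2))%N else 0%N.

Let idx j := (2 * total j + j + 2)%N.
Let xx n := Num.sqrt (rr n ^+ 2 - tt n ^+ 2).

(** The points are spread over a horizontal segment because Lambda is a set: the zeros to be counted
    must be distinct. The abscissa [xx n] gives the point i = 0 the modulus [rr n]. *)
Definition point n i : R[i] := (xx n + ee n * (i%:R / (mult n)%:R)) +i* (- tt n).

Definition cluster_set : set R[i] :=
  [set z | exists j i, (i < mult (idx j))%N /\ z = point (idx j) i].

Let rr_gt0 n : 0 < rr n.
Proof. by have [[h _] _ _ _ _] := spec n; apply: le_lt_trans h; rewrite ler0n. Qed.

Let rho_ge0 n : 0 <= rho (rr n) / 2.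
Proof. by rewrite divr_ge0// ltW// rho_pos// ltW. Qed.

Lemma point_cmod n i : (i < mult n)%N ->
  rr n <= cmod (point n i) /\ cmod (point n i) <= rr n + ee n.
Proof.
move=> im; have [[nr tr] nt _ /andP[e0 e1] _] := spec n.
have t0 : 0 <= tt n by apply: le_trans nt; rewrite ler0n.
pose d := ee n * (i%:R / (mult n)%:R); have m0 : 0 < (mult n)%:R :> R by rewrite ltr0n
  (leq_ltn_trans _ im).
have d0 : 0 <= d by rewrite mulr_ge0 ?divr_ge0// ltW.
have de : d <= ee n.
  by rewrite ler_piMr ?(ltW e0)// ler_pdivrMr// mul1r ler_nat ltnW.
have x0 : 0 <= xx n by exact: sqrtr_ge0.
have x2 : xx n ^+ 2 = rr n ^+ 2 - tt n ^+ 2.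
  by rewrite sqr_sqrtr// subr_ge0 lerXn2r ?nnegrE ?(ltW (rr_gt0 _))// ltW.
have xr : xx n <= rr n.
  rewrite -ler_sqr ?nnegrE ?(ltW (rr_gt0 _))// x2.
  by have := sqr_ge0 (tt n); lra.
have E : cmod (point n i) ^+ 2 = rr n ^+ 2 + 2 * xx n * d + d ^+ 2.
  rewrite /cmod /= sqr_sqrtr ?addr_ge0 ?sqr_ge0// -/d sqrrN.
  by rewrite [RHS](_ : _ = (xx n + d) ^+ 2 + (rr n ^+ 2 - xx n ^+ 2)); [rewrite x2; ring|ring].
have c0 : 0 <= cmod (point n i) by exact: sqrtr_ge0.
have r0 := ltW (rr_gt0 n); have xd := mulr_ge0 x0 d0; have d2 := sqr_ge0 d.
split; rewrite -ler_sqr ?nnegrE ?addr_ge0 ?(ltW e0)// E; first lra.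
have := ler_wpM2r d0 xr.
have : d ^+ 2 <= ee n ^+ 2 by rewrite lerXn2r ?nnegrE// ltW.
have := ler_wpM2l r0 de; lra.
Qed.

Lemma cluster_set_tau z : cluster_set z -> tau (cmod z) <= - complex.Im z.
Proof.
move=> [j [i [im ->]]]; have [h1 h2] := point_cmod im.
by have [_ _ _ _ h] := spec (idx j); rewrite /= opprK; exact: h.
Qed.

(** Here rho is split into halves: the new cluster takes at most rho / 2, and the earlier points
    number at most idx j / 2 <= idx j t / 2 <= rho / 2, as t >= 1. *)
Lemma total_le j : (total j.+1)%:R <= rho (rr (idx j)).
Proof.
have [_ h1 h2 _ _] := spec (idx j).
have m1 : (mult (idx j))%:R <= rho (rr (idx j)) / 2.
  by have /andP[] := truncn_itv (rho_ge0 (idx j)).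
have h3 : (2 * total j)%:R <= (idx j)%:R :> R by rewrite ler_nat /idx -addnA leq_addr.
have h4 : 2 <= (idx j)%:R :> R by rewrite (ler_nat _ 2) /idx leq_addl.
have h5 : (idx j)%:R <= (idx j)%:R * tt (idx j).
  by rewrite ler_peMr//; lra.
rewrite /= natrD -/(idx j); move: h3; rewrite natrM.
by have := le_trans h5 h2; lra.
Qed.

(** Clusters meeting the disc have radius [rr (idx j)] below r, and these are finitely many since
    that radius exceeds j. The radii need not increase with j, so J is taken as the largest such
    index: the first J + 1 clusters contain all the points, and [total_le] at J applies. *)
Lemma cluster_set_counting r : 0 <= r -> (counting_function cluster_set r <= (rho r)%:E)%E.
Proof.
move=> r_ge0; have idx_lt j : rr (idx j) < r -> (j <= Num.truncn r)%N.
  move=> jr; have [[h _] _ _ _ _] := spec (idx j).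
  rewrite -ltnS -(ltr_nat R); have /andP[_ rS] := truncn_itv r_ge0.
  apply: le_lt_trans rS; apply: (@le_trans _ _ (idx j)%:R); last exact: ltW (lt_trans h jr).
  by rewrite ler_nat /idx addnAC leq_addl.
have [ex|nex] := pselect (exists j, rr (idx j) < r); last first.
  apply: (@le_trans _ _ (size (Nil R[i]))%:R%:E); last by rewrite lee_fin ltW// rho_pos.
  apply: counting_le_size => z /= [[j [i [im ->]]] zr]; exfalso; apply: nex; exists j.
  exact: le_lt_trans (point_cmod im).1 zr.
have [J JP Jmax] := ex_maxnP ex idx_lt.
pose L := [seq point (idx j) i | j <- iota 0 J.+1, i <- iota 0 (mult (idx j))].
have sizeL N : size [seq point (idx j) i | j <- iota 0 N, i <- iota 0 (mult (idx j))] = total N.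
  elim: N => [//|N IH]; rewrite -[N.+1]addn1 iotaD allpairs_cat size_cat IH /= cats0 size_map
    size_iota.
  by rewrite add0n addn1.
apply: (@le_trans _ _ (size L)%:R%:E).
  apply: counting_le_size => z /= [[j [i [im ->]]] zr].
  apply/allpairsPdep; exists j, i; rewrite !mem_iota !add0n /= im ltnS; split=> //.
  by apply: Jmax; exact: le_lt_trans (point_cmod im).1 zr.
rewrite sizeL lee_fin; apply: le_trans (total_le J) _.
apply: rho_incr; rewrite ?in_itv/= ?andbT//; last exact: ltW.
by rewrite ltW// rr_gt0.
Qed.

Lemma cluster_set_nonres q : potential q -> ~ (cluster_set `<=` resonances q).
Proof.
move=> /potential_cut[M [q' [M0 iq' q'0 qq']]] sub.
set Q := - prim M (fun t => `|q' t|) 0.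
have Q0 : 0 <= Q by exact: norm_q_ge0.
(* The threshold of [cluster_arith]: the cluster is chosen beyond a constant of the potential. *)
pose j := (Num.truncn (27 * Q + 4 * (11 + 3 * Q + 19 * M))).+1.
pose n := idx j.
have jn : 27 * Q + 4 * (11 + 3 * Q + 19 * M) <= n%:R.
  apply: (@le_trans _ _ j%:R); last by rewrite ler_nat /n /idx addnAC leq_addl.
  have : 0 <= 27 * Q + 4 * (11 + 3 * Q + 19 * M) by lra.
  by move=> /truncn_itv/andP[_ /ltW].
have [[nr tr] nt h2 /andP[e0 e1] _] := spec n.
have n2 : 2 <= n%:R :> R by rewrite (ler_nat _ 2) /n /idx leq_addl.
have T0 : 0 < tt n by lra.
have QT : 27 * Q <= tt n by lra.
(* The centre is the reflection of the first point of the cluster in the real axis; with width at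
   most 1 and vertical distance 2 T, the cluster stays within 2 T + 1. *)
have := @zeros_bound R M q' q M0 iq' q'0 qq' (tt n)
  (xx n +i* tt n) [seq point n i | i <- iota 0 (mult n)] T0 QT erefl _ _.
rewrite size_map size_iota => h.
have {}h : 1 / 2 <= jost_cst M q' * expR (2 * M * (5 * tt n + 3)) / 2 ^+ mult n.
  apply: h.
    rewrite map_inj_in_uniq ?iota_uniq// => a b; rewrite !mem_iota !add0n /= => am bm.
    have m0 : 0 < (mult n)%:R :> R by rewrite ltr0n (leq_ltn_trans _ am).
    rewrite /point => -[] /addrI /(mulfI (lt0r_neq0 e0)) /(mulIf (invr_neq0
      (lt0r_neq0 m0))) /eqP.
    by rewrite eqr_nat => /eqP.
  move=> z zs; have [i + ->] := mapP zs.
  rewrite mem_iota add0n leq0n andTb => im; split; last first.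
    by have [] : resonances q (point n i) by apply: sub; exists j, i.
  have m0 : 0 < (mult n)%:R :> R by rewrite ltr0n (leq_ltn_trans _ im).
  pose d := ee n * (i%:R / (mult n)%:R).
  have d0 : 0 <= d by rewrite mulr_ge0 ?divr_ge0// ltW.
  have de : d <= 1.
    apply: le_trans e1; rewrite ler_piMr ?(ltW e0)// ler_pdivrMr// mul1r ler_nat ltnW//.
  apply: le_trans (cmod_le_ReIm _) _.
  have -> : point n i - (xx n +i* tt n) = d +i* (- 2 * tt n).
    by rewrite /point -/d; apply/eqP; rewrite eq_complex; apply/andP; split; apply/eqP;
      simpl; ring.
  by rewrite /= (ger0_norm d0) mulNr normrN ger0_norm ?mulr_ge0 ?(ltW T0)//; lra.
have m2 : 0 < 2 ^+ mult n :> R by rewrite exprn_gt0.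
move: h; rewrite ler_pdivlMr// => h.
have h5 : expR ((mult n)%:R / 2) <= 2 * (jost_cst M q' * expR (2 * M * (5 * tt n + 3))).
  move: h (expR_half_le R (mult n)); move: (_ * expR (2 * M * _)) => X h h'.
  by apply: le_trans h' _; rewrite -ler_pdivrMl// mulrC -[_^-1]mul1r mulrC.
have h6 : expR ((mult n)%:R / 2) <= expR (9 + (3 * Q + 3 * M) + 2 * M * (5 * tt n + 3)).
  (* The 10 is twice the 5 of [jost_cst], and exp 9 absorbs it into the exponent. *)
  have h10 := ten_le_expR9 R.
  apply: le_trans h5 _; rewrite /jost_cst -/Q [leRHS]expRD [expR (9 + _)]expRD.
  rewrite [leLHS](_ : _ = 10 * expR (3 * Q + 3 * M) * expR (2 * M * (5 * tt n + 3)));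
    last by ring.
  by rewrite ler_wpM2r ?expR_ge0// ler_wpM2r ?expR_ge0.
move: h6; rewrite ler_expR => h6.
have m1 : rho (rr n) / 2 < (mult n)%:R + 1.
  by rewrite natr1; have /andP[] := truncn_itv (rho_ge0 n).
have t1 : 1 <= tt n by apply: le_trans nt; apply: le_trans n2; rewrite ler1n.
exact: (cluster_arith Q0 (ltW M0) t1 jn h2 m1 h6).
Qed.

End construction.

Theorem theorem1p3 (R : realType) (tau rho : R -> R)
  (tau_pos : forall r : R, 0 <= r -> 0 < tau r)
  (rho_pos : forall r : R, 0 <= r -> 0 < rho r)
  (tau_unbounded : forall M : R, exists2 r : R, 0 <= r & M < tau r)
  (rho_unbounded : forall M : R, exists2 r : R, 0 <= r & M < rho r)
  (tau_incr : {in `[0, +oo[ &, {homo tau : r s / r <= s}})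
  (rho_incr : {in `[0, +oo[ &, {homo rho : r s / r <= s}})
  (tau_cont : {within `[0, +oo[, continuous tau})
  (rho_cont : {within `[0, +oo[, continuous rho})
  (tau_o_rho : forall e : R, 0 < e ->
     \forall r \near +oo, `|tau r| <= e * `|rho r|)
  (* Without this the set {z | tau |z| <= - Im z} may be empty, and with it
     Lambda, which makes the conclusion false. *)
  (tau_lt_id : forall M : R, exists2 r : R, M < r & tau r < r) :
  exists Lambda : set R[i],
    [/\ Lambda `<=` [set z | tau (cmod z) <= - complex.Im z],
        forall r : R, 0 <= r -> (counting_function Lambda r <= (rho r)%:E)%E &
        forall q : R -> R, potential q -> ~ (Lambda `<=` resonances q)].
Proof.
exists (cluster_set tau_pos rho_pos tau_unbounded tau_incr tau_cont tau_o_rho tau_lt_id); split.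
- by move=> z /cluster_set_tau.
- exact: cluster_set_counting.
- exact: cluster_set_nonres.
Qed.
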